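(* Let $r\in\mathbb{N}$ and let $\sigma(a_1,\ldots,a_r)$ be a sentence of $\mathrm{TCMSOL}$ with constant symbols $a_1,\ldots,a_r$. Let $S^t(n)$ be the number of topologies $\mathcal{U}$ on $[n]$ such that $([n],\mathcal{U},E,a_1,\ldots,a_r)\models\sigma(a_1,\ldots,a_r)$, and let $\hat S^t(n)$ be the number of topologies $\mathcal{U}$ on $[n]$ such that $([n],\mathcal{U},E,a_1,\ldots,a_r)\models\neg\sigma(a_1,\ldots,a_r)$. Then, both in the case where the constant symbols are hard-wired and in the case where they are not: (i) $S^t(n)$ and $\hat S^t(n)$ are MC-finite; (ii) at least one of $S^t(n)$ and $\hat S^t(n)$ is not C-finite.
   Context: A finite topological space $(X,\mathcal{U})$ is identified with the two-sorted structure $(X,\mathcal{U},E)$ with $E(x,U)$ iff $x\in U$. $\mathrm{TCMSOL}$ is monadic second order logic for such structures: variables range over elements of $X$, over subsets of $X$ (with quantification over them), and over elements of $\mathcal{U}$ (first-order quantification over open sets only); atomic formulas are equalities, $E(x,U)$, and $S(x)$ for a set variable $S$; formulas are closed under Boolean connectives, these quantifiers, and modular counting quantifiers $C_{m,a}x\,\phi(x)$ expressing that the number of $x$ satisfying $\phi(x)$ is congruent to $a$ modulo $m$. Constant symbols $a_1,\ldots,a_r$ denote elements of $X$. The constants are hard-wired if $a_i$ is interpreted as $i\in[n]$; if not hard-wired, each interpretation of $a_1,\dots,a_r$ in $[n]$ together with the topology is counted as a separate structure. A sequence $s(n)$ is C-finite if there are $p,q\in\mathbb{N}$, $c_i\in\mathbb{Z}$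 with $s(n+p)=\sum_{i=0}^{p-1}c_is(n+i)$ for all $n\ge q$; it is MC-finite if for every $m\in\mathbb{N}^+$ the sequence $s(n)\bmod m$ is ultimately periodic (equivalently satisfies a linear recurrence with constant coefficients modulo $m$ for large $n$). *)

(* Defs.v *)
From mathcomp Require Import all_boot all_order all_algebra.

Set Implicit Arguments.
Unset Strict Implicit.
Unset Printing Implicit Defensive.

Definition is_topology (T : finType) (O : {set {set T}}) : bool :=
  [&& set0 \in O, [set: T] \in O,
      [forall A in O, forall B in O, A :&: B \in O] &
      [forall F : {set {set T}}, (F \subset O) ==> (cover F \in O)]].

(* Syntax of TCMSOL, with well-scoped de Bruijn indices: [formula r e s o] has
   constant symbols indexed by 'I_r, and free variables among e element
   variables, s set variables and o open-set variables. Index 0 is the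
   variable bound by the innermost quantifier of the sort. *)
Inductive term (r e : nat) : Type :=
| Var of 'I_e
| Cst of 'I_r.

Inductive formula (r e s o : nat) : Type :=
| EqX of term r e & term r e
| EqS of 'I_s & 'I_s
| EqO of 'I_o & 'I_o
| InO of term r e & 'I_o
| InS of term r e & 'I_s
| Not of formula r e s o
| And of formula r e s o & formula r e s o
| Or of formula r e s o & formula r e s o
| AllX of formula r e.+1 s o
| ExX of formula r e.+1 s o
| AllS of formula r e s.+1 o
| ExS of formula r e s.+1 o
| AllO of formula r e s o.+1
| ExO of formula r e s o.+1
| Count (m a : nat) of 0 < m & formula r e.+1 s o.

Definition sentence (r : nat) : Type := formula r 0 0 0.

Definition env_nil (A : Type) (i : 'I_0) : A :=
  let: Ordinal k lt_k0 := i in False_rect A (notF lt_k0).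

Definition env_cons (A : Type) (k : nat) (a : A) (v : 'I_k -> A) : 'I_k.+1 -> A :=
  fun i => if unlift ord0 i is Some j then v j else a.

Definition teval (T : Type) (r e : nat) (c : 'I_r -> T) (x : 'I_e -> T)
    (t : term r e) : T :=
  match t with Var i => x i | Cst i => c i end.

Fixpoint holds (T : finType) (O : {set {set T}}) (r e s o : nat)
    (c : 'I_r -> T) (x : 'I_e -> T) (S : 'I_s -> {set T}) (V : 'I_o -> {set T})
    (phi : formula r e s o) {struct phi} : bool :=
  match phi with
  | EqX t u => teval c x t == teval c x u
  | EqS i j => S i == S j
  | EqO i j => V i == V j
  | InO t i => teval c x t \in V i
  | InS t i => teval c x t \in S i
  | Not f => ~~ holds O c x S V f
  | And f g => holds O c x S V f && holds O c x S V g
  | Or f g => holds O c x S V f || holds O c x S V g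
  | AllX f => [forall y : T, holds O c (env_cons y x) S V f]
  | ExX f => [exists y : T, holds O c (env_cons y x) S V f]
  | AllS f => [forall A : {set T}, holds O c x (env_cons A S) V f]
  | ExS f => [exists A : {set T}, holds O c x (env_cons A S) V f]
  | AllO f => [forall A in O, holds O c x S (env_cons A V) f]
  | ExO f => [exists A in O, holds O c x S (env_cons A V) f]
  | Count m a _ f =>
      #|[set y : T | holds O c (env_cons y x) S V f]| == a %[mod m]
  end.

Definition models (T : finType) (O : {set {set T}}) (r : nat) (c : 'I_r -> T)
    (sigma : sentence r) : bool :=
  holds O c (@env_nil T) (@env_nil {set T}) (@env_nil {set T}) sigma.

(* [n] is 'I_n = {0, ..., n-1} and the constants are numbered from 0. The
   hard-wired interpretation is unique, and exists iff r <= n: for n < r there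
   is no structure to count, and both counts below are then 0. *)
Definition hardwired (r n : nat) (c : {ffun 'I_r -> 'I_n}) : bool :=
  [forall i : 'I_r, (c i : nat) == i].

Definition count_hardwired (r : nat) (sigma : sentence r) (n : nat) : nat :=
  #|[set O : {set {set 'I_n}} | is_topology O &
      [exists c : {ffun 'I_r -> 'I_n}, hardwired c && models O c sigma]]|.

Definition count_free (r : nat) (sigma : sentence r) (n : nat) : nat :=
  #|[set p : {set {set 'I_n}} * {ffun 'I_r -> 'I_n} |
      is_topology p.1 & models p.1 p.2 sigma]|.

Definition C_finite (s : nat -> nat) : Prop :=
  exists (p q : nat) (c : 'I_p -> int), forall n, q <= n ->
    ((s (n + p)%N)%:Z = \sum_(i < p) c i * (s (n + i)%N)%:Z)%R.

Definition MC_finite (s : nat -> nat) : Prop :=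
  forall m, 0 < m -> exists p q : nat,
    0 < p /\ forall n, q <= n -> s (n + p) = s n %[mod m].

(* Main.v *)
Require Import Defs.
From mathcomp Require Import all_boot all_order all_algebra.
From mathcomp Require Import all_fingroup all_solvable ring zify.
From Stdlib Require Import Classical.

(** Finite topologies are the families of up-sets of preorders, so the counts
    run over irreflexive relations [E] on [n] points that are transitive off the
    diagonal.  For a fixed quantifier rank and modulus, monadic types are finite
    in number and compose: if a structure is obtained by substituting structures
    for the points of a relation, its type depends only on that relation and on
    the types of the substituted parts.  Hence one may count, for every word [w]
    of types, the relations on the letters of [w] whose sum has a given type.

    Let [p ^ k] letters of [w] coincide and let the [k]-fold iterated wreath
    product of cyclic groups of order [p] permute them.  If the orbit of a
    relation is not divisible by [p ^ k], then for some node of the [p]-ary tree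
    the stabiliser contains permutations that fix all points off the node and act
    transitively on its leaves; these leaves then form a module, which can be
    replaced by one letter.  Inclusion-exclusion over the nodes expresses the
    count of [w], modulo [p ^ k], through counts of shorter words, with
    coefficients independent of the other letters.  So all counts are determined
    by those of boundedly long prefixes, and the pigeonhole principle gives
    periodicity modulo prime powers, hence modulo every [m].

    C-finite sequences grow at most exponentially, whereas there are at least
    [2 ^ (k * k)] topologies on [2 * k] points, so the counts for [sigma] and its
    negation cannot both be C-finite. *)

Set Implicit Arguments.
Unset Strict Implicit.
Unset Printing Implicit Defensive.

(** * Monadic types and their composition *)

Section Types.

Variable M : nat.

(* What a rank-0 type records about sets [S_l], [l < s]: which are inhabited,
   their cardinals modulo [M.+1], the inclusions between them, and whether some
   edge goes from [S_l] to [S_k]. *)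
Definition atom (s : nat) : finType :=
  ({ffun 'I_s -> bool} * {ffun 'I_s -> 'I_M.+1} *
   {ffun 'I_s * 'I_s -> bool} * {ffun 'I_s * 'I_s -> bool})%type.

Definition mk_atom s (n : 'I_s -> bool) (c : 'I_s -> 'I_M.+1)
    (u r : 'I_s -> 'I_s -> bool) : atom s :=
  (finfun n, finfun c, [ffun lk => u lk.1 lk.2], [ffun lk => r lk.1 lk.2]).

Definition atom_inh s (a : atom s) (l : 'I_s) : bool := a.1.1.1 l.
Definition atom_cnt s (a : atom s) (l : 'I_s) : 'I_M.+1 := a.1.1.2 l.
Definition atom_sub s (a : atom s) (l k : 'I_s) : bool := a.1.2 (l, k).
Definition atom_rel s (a : atom s) (l k : 'I_s) : bool := a.2 (l, k).

Lemma atom_inhE s n c u r l : atom_inh (@mk_atom s n c u r) l = n l.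
Proof. by rewrite /atom_inh ffunE. Qed.
Lemma atom_cntE s n c u r l : atom_cnt (@mk_atom s n c u r) l = c l.
Proof. by rewrite /atom_cnt ffunE. Qed.
Lemma atom_subE s n c u r l k : atom_sub (@mk_atom s n c u r) l k = u l k.
Proof. by rewrite /atom_sub ffunE. Qed.
Lemma atom_relE s n c u r l k : atom_rel (@mk_atom s n c u r) l k = r l k.
Proof. by rewrite /atom_rel ffunE. Qed.

Definition atomE := (atom_inhE, atom_cntE, atom_subE, atom_relE).

Lemma atom_eq s (a b : atom s) :
    atom_inh a =1 atom_inh b -> atom_cnt a =1 atom_cnt b ->
    atom_sub a =2 atom_sub b -> atom_rel a =2 atom_rel b -> a = b.
Proof.
case: a b => [[[n c] u] r] [[[n' c'] u'] r'] /= en ec eu er.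
have -> : n = n' by apply/ffunP=> l; apply: en.
have -> : c = c' by apply/ffunP=> l; apply: ec.
have -> : u = u' by apply/ffunP=> -[l k]; apply: eu.
by have -> : r = r' by apply/ffunP=> -[l k]; apply: er.
Qed.

(** Ehrenfeucht-Fraisse types: one more round records which types of rank [q'] arise when one
    further set is named. Only sets are named; elements enter later as singletons. *)
Fixpoint typ (q s : nat) : finType :=
  if q is q'.+1 then (typ q' s * {set typ q' s.+1})%type : finType else atom s.

(** The atom of the Feferman-Vaught sum in which each point [i] of [D] is replaced by a structure
    with atom [tau i]: an edge between two sets lies inside one part, or comes from an edge of [E]
    between two distinct parts that meet them. *)
Definition sum_atom s (T : finType) (D : {set T}) (E : {set T * T})
    (tau : T -> atom s) : atom s :=
  mk_atom (fun l => [exists i in D, atom_inh (tau i) l])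
    (fun l => \sum_(i in D) atom_cnt (tau i) l)%R
    (fun l k => [forall i in D, atom_sub (tau i) l k])
    (fun l k => [exists i in D, atom_rel (tau i) l k] ||
       [exists i in D, exists j in D, [&& i != j, (i, j) \in E,
          atom_inh (tau i) l & atom_inh (tau j) k]]).

(** A set in a sum is an independent choice of a set in each part, so naming one more set leads to
    the sums of the choices [t] from the second components. *)
Fixpoint sum_typ (q : nat) : forall (s : nat) (T : finType) (D : {set T})
    (E : {set T * T}) (tau : T -> typ q s), typ q s :=
  match q with
  | 0 => sum_atom
  | q'.+1 => fun s T D E tau =>
     (sum_typ D E (fun i => (tau i).1),
      [set sum_typ D E t | t : {ffun T -> typ q' s.+1} &
                        [forall i in D, t i \in (tau i).2]])
  end.

Lemma sum_typ_ext q s (T : finType) (D : {set T}) (E E' : {set T * T})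
    (tau tau' : T -> typ q s) :
    {in D &, forall i j, i != j -> ((i, j) \in E) = ((i, j) \in E')} ->
    {in D, tau =1 tau'} ->
  sum_typ D E tau = sum_typ D E' tau'.
Proof.
elim: q s tau tau' => [|q IHq] s tau tau' eqE eqt /=.
  apply: atom_eq => [l|l|l k|l k]; rewrite !atomE.
  - by apply: eq_existsb => i; case Di: (i \in D) => //=; rewrite eqt.
  - by apply: eq_bigr => i Di; rewrite eqt.
  - by apply: eq_forallb => i; case Di: (i \in D) => //=; rewrite eqt.
  congr (_ || _).
    by apply: eq_existsb => i; case Di: (i \in D) => //=; rewrite eqt.
  apply: eq_existsb => i; case Di: (i \in D) => //=.
  apply: eq_existsb => j; case Dj: (j \in D) => //=.
  by case: eqVneq => //= neq_ij; rewrite eqE // !eqt.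
congr (_, _); first by apply: IHq => // i Di; rewrite eqt.
apply/setP=> x; apply/imsetP/imsetP => -[t].
  rewrite inE => /forall_inP tP ->; exists t; last exact: IHq.
  by rewrite inE; apply/forall_inP=> i Di; rewrite -eqt ?tP.
rewrite inE => /forall_inP tP ->; exists t; last by apply/esym/IHq.
by rewrite inE; apply/forall_inP=> i Di; rewrite eqt ?tP.
Qed.

Lemma sum_typ_set1 q s (T : finType) (x : T) (E : {set T * T}) (tau : T -> typ q s) :
  sum_typ [set x] E tau = tau x.
Proof.
elim: q s tau => [|q IHq] s tau /=.
  apply: atom_eq => [l|l|l k|l k]; rewrite !atomE.
  - apply/exists_inP/idP => [[i] /set1P-> //|xl]; exists x => //.
    exact: set11.
  - by rewrite big_set1.
  - apply/forall_inP/idP => [h|h i /set1P-> //]; apply: h; exact: set11.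
  apply/orP/idP => [[/exists_inP[i /set1P-> //]|]|xl].
    move=> /exists_inP[i /set1P-> /exists_inP[j /set1P->]].
    by rewrite eqxx.
  by left; apply/exists_inP; exists x; first exact: set11.
rewrite IHq [RHS]surjective_pairing; congr (_, _).
apply/setP=> y; apply/imsetP/idP => [[t] | ty].
  by rewrite inE IHq => /forall_inP tP ->; apply: tP; exact: set11.
exists [ffun => y]; last by rewrite IHq ffunE.
by rewrite inE; apply/forall_inP=> i /set1P->; rewrite ffunE.
Qed.

(* Associativity of composition: summing the fibres of [f] first gives the
   same type, provided [E] does not separate points of one fibre. *)
Lemma sum_typ_fiber q s (T T' : finType) (f : T -> T') (D : {set T})
    (E : {set T * T}) (E' : {set T' * T'})
    (tau : T -> typ q s) (tau' : T' -> typ q s) :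
    {in D &, forall i j, f i != f j ->
      ((i, j) \in E) = ((f i, f j) \in E')} ->
    {in D, forall i, tau' (f i) = sum_typ [set j in D | f j == f i] E tau} ->
  sum_typ D E tau = sum_typ (f @: D) E' tau'.
Proof.
elim: q s tau tau' => [|q IHq] s tau tau' eqE eqt /=.
  have inh l y : y \in f @: D -> atom_inh (tau' y) l =
      [exists i in [set j in D | f j == y], atom_inh (tau i) l].
    by case/imsetP=> i Di ->; rewrite eqt // atomE.
  apply: atom_eq => [l|l|l k|l k]; rewrite !atomE.
  - apply/exists_inP/exists_inP => [[i Di il]|[y fDy]].
      exists (f i); first exact: imset_f.
      rewrite inh ?imset_f //; apply/exists_inP; exists i => //.
      by rewrite inE Di eqxx.
    rewrite inh // => /exists_inP[i]; rewrite inE => /andP[Di _] il.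
    by exists i.
  - rewrite (partition_big_imset f) /=; apply: eq_bigr => y /imsetP[i Di ->].
    by rewrite eqt // atomE; apply: eq_bigl => j; rewrite inE.
  - apply/forall_inP/forall_inP => [h y /imsetP[i Di ->]|h i Di].
      rewrite eqt // atomE; apply/forall_inP=> j.
      by rewrite inE => /andP[Dj _]; apply: h.
    have := h _ (imset_f f Di); rewrite eqt // atomE => /forall_inP/(_ i).
    by rewrite inE Di eqxx => ->.
  apply/orP/orP.
    case=> [/exists_inP[i Di il]|].
      left; apply/exists_inP; exists (f i); first exact: imset_f.
      rewrite eqt // atomE; apply/orP; left; apply/exists_inP; exists i => //.
      by rewrite inE Di eqxx.
    case/exists_inP=> i Di /exists_inP[j Dj /and4P[nij Eij il jk]].
    have [eqf|neqf] := eqVneq (f i) (f j).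
      left; apply/exists_inP; exists (f i); first exact: imset_f.
      rewrite eqt // atomE; apply/orP; right.
      apply/exists_inP; exists i; first by rewrite inE Di eqxx.
      apply/exists_inP; exists j; first by rewrite inE Dj eqf eqxx.
      by rewrite nij Eij il jk.
    right; apply/exists_inP; exists (f i); first exact: imset_f.
    apply/exists_inP; exists (f j); first exact: imset_f.
    rewrite neqf -eqE // Eij !inh ?imset_f //=; apply/andP; split.
      by apply/exists_inP; exists i => //; rewrite inE Di eqxx.
    by apply/exists_inP; exists j => //; rewrite inE Dj eqxx.
  case=> [/exists_inP[y /imsetP[i Di ->]]|].
    rewrite eqt // atomE => /orP[/exists_inP[j]|].
      rewrite inE => /andP[Dj _] jl; left; apply/exists_inP; exists j => //.
    case/exists_inP=> i'; rewrite inE => /andP[Di' _].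
    case/exists_inP=> j'; rewrite inE => /andP[Dj' _] h.
    right; apply/exists_inP; exists i' => //.
    by apply/exists_inP; exists j'.
  case/exists_inP=> y fDy /exists_inP[z fDz /and4P[nyz Eyz]].
  rewrite !inh // => /exists_inP[i]; rewrite inE => /andP[Di /eqP fi] il.
  case/exists_inP=> j; rewrite inE => /andP[Dj /eqP fj] jk.
  right; apply/exists_inP; exists i => //; apply/exists_inP; exists j => //.
  rewrite il jk eqE ?fi ?fj ?Eyz ?andbT //.
  by apply: contraNneq nyz => eij; rewrite -fi -fj eij.
congr (_, _).
  by apply: IHq => // i Di; rewrite eqt.
apply/setP=> x; apply/imsetP/imsetP => -[t]; rewrite inE => /forall_inP tP ->.
  exists [ffun y => sum_typ [set j in D | f j == y] E t].
    rewrite inE; apply/forall_inP=> y /imsetP[i Di ->]; rewrite ffunE eqt //=.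
    apply/imsetP; exists t => //; rewrite inE; apply/forall_inP=> j.
    by rewrite inE => /andP[Dj _]; apply: tP.
  by apply: IHq => // i Di; rewrite ffunE.
(* Each fibre supplies its own choice [u y]; the choices are then glued along [f] into one choice on
   [D]. Off the image of [f] a dummy is returned. *)
have ex (y : T') : exists u : {ffun T -> typ q s.+1}, y \in f @: D ->
     {in [set j in D | f j == y], forall i, u i \in (tau i).2} /\
     t y = sum_typ [set j in D | f j == y] E u.
  have [fDy|/negPf nfDy] := boolP (y \in f @: D); last by exists [ffun=> t y].
  have := tP _ fDy; case/imsetP: fDy => i Di ->; rewrite eqt //=.
  case/imsetP=> u; rewrite inE => /forall_inP uP ->.
  by exists u => _; split=> // j /uP.
have [u uP] := fin_all_exists ex.
exists [ffun i => u (f i) i].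
  rewrite inE; apply/forall_inP=> i Di; rewrite ffunE.
  have [h _] := uP _ (imset_f f Di); apply: h.
  by rewrite inE Di eqxx.
apply/esym/IHq => // i Di; have [_ ->] := uP _ (imset_f f Di).
apply: sum_typ_ext => // j; rewrite inE => /andP[_ /eqP fj].
by rewrite ffunE fj.
Qed.

Lemma sum_typ_inj q s (T T' : finType) (f : T -> T') (D : {set T})
    (E : {set T * T}) (E' : {set T' * T'})
    (tau : T -> typ q s) (tau' : T' -> typ q s) :
    {in D &, injective f} ->
    {in D &, forall i j, i != j -> ((i, j) \in E) = ((f i, f j) \in E')} ->
    {in D, forall i, tau' (f i) = tau i} ->
  sum_typ D E tau = sum_typ (f @: D) E' tau'.
Proof.
move=> injf eqE eqt; apply: sum_typ_fiber => [i j Di Dj nij|i Di].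
  by apply: eqE => //; apply: contraNneq nij => ->.
rewrite eqt // -[LHS](sum_typ_set1 i E).
have <- // : [set j in D | f j == f i] = [set i].
apply/setP=> j; rewrite !inE; apply/andP/eqP => [[Dj /eqP]|->]; last by [].
exact: injf.
Qed.

(** [mu l] tells whether the point lies in set [l]. Loops are invisible, hence the constant [false];
    a further set contains the point or misses it, hence the image over [b]. *)
Fixpoint point_typ q : forall s, ('I_s -> bool) -> typ q s :=
  match q with
  | 0 => fun s mu => mk_atom mu (fun l => inZp (mu l))
           (fun l k => mu l ==> mu k) (fun _ _ => false)
  | q'.+1 => fun s mu =>
      (point_typ q' mu, [set point_typ q' (env_cons b mu) | b : bool])
  end.

Lemma env_cons_ext (A : Type) k (a : A) (v w : 'I_k -> A) :
  v =1 w -> env_cons a v =1 env_cons a w.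
Proof. by move=> eqvw i; rewrite /env_cons; case: unlift. Qed.

Lemma env_cons_map (A B : Type) (f : A -> B) k (a : A) (v : 'I_k -> A) i :
  env_cons (f a) (f \o v) i = f (env_cons a v i).
Proof. by rewrite /env_cons; case: unlift. Qed.

Lemma point_typ_ext q s (mu nu : 'I_s -> bool) :
  mu =1 nu -> point_typ q mu = point_typ q nu.
Proof.
elim: q s mu nu => [|q IHq] s mu nu eqmu /=.
  by apply: atom_eq => [l|l|l k|l k]; rewrite !atomE ?eqmu.
congr (_, _); first exact: IHq.
by apply: eq_imset => b; apply/IHq/env_cons_ext.
Qed.

Definition rank_typ q s (T : finType) (E : {set T * T})
    (W : 'I_s -> {set T}) : typ q s :=
  sum_typ [set: T] E (fun i => point_typ q (fun l => i \in W l)).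

(** A subset of the carrier amounts to choosing, at each point, one of its two one-point types; so
    naming a set in the structure agrees with choosing [t] in the sum. This gives the back-and-forth
    reading of [rank_typ]. *)
Lemma rank_typS q s (T : finType) (E : {set T * T}) (W : 'I_s -> {set T}) :
  rank_typ q.+1 E W =
  (rank_typ q E W, [set rank_typ q E (env_cons A W) | A : {set T}]).
Proof.
rewrite {1}/rank_typ /=; congr (_, _).
have ptE (A : {set T}) i b : (i \in A) = b ->
    point_typ q (fun l => i \in env_cons A W l) =
    point_typ q (env_cons b (fun l => i \in W l)).
  move=> Ai; apply: point_typ_ext => l; rewrite -Ai.
  by rewrite -(env_cons_map (fun B : {set T} => i \in B)).
apply/setP=> x; apply/imsetP/imsetP => [[t]|[A _ ->]].
  rewrite inE => /forall_inP tP ->.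
  (* The set is read off from [t]; where the two one-point types coincide, either reading gives the
     same type. *)
  exists [set i | t i == point_typ q (env_cons true (fun l => i \in W l))] => //.
  apply: sum_typ_ext => // i _.
  have /imsetP[b _ tb] := tP i (in_setT i).
  pose P := point_typ q (env_cons true (fun l => i \in W l)).
  case: (boolP (t i == P)) => [/eqP tiP|ntiP].
    by rewrite tiP; apply/esym/ptE; rewrite inE tiP eqxx.
  rewrite tb; apply/esym/ptE; rewrite inE (negPf ntiP).
  by case: b tb => // tb; rewrite tb /P eqxx in ntiP.
exists [ffun i => point_typ q (env_cons (i \in A) (fun l => i \in W l))].
  rewrite inE; apply/forall_inP=> i _; rewrite ffunE.
  exact: imset_f.
by apply: sum_typ_ext => // i _; rewrite ffunE; apply: ptE.
Qed.

End Types.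

(** * Iterated wreath products *)

Section Wreath.

Import GroupScope.

(** For a group [H]: transitivity on [A] of the pointwise stabiliser in [H] of the complement of
    [A]. *)
Definition rigid_trans (T : finType) (H : {set {perm T}}) (A : {set T}) : bool :=
  [forall x in A, forall y in A, exists s in H, perm_on A s && (s x == y)].

Lemma rigid_transP (T : finType) (H : {set {perm T}}) (A : {set T}) :
  reflect {in A &, forall x y, exists s, [/\ s \in H, perm_on A s & s x = y]}
          (rigid_trans H A).
Proof.
apply: (iffP forall_inP) => [h x y Ax Ay|h x Ax].
  have /forall_inP/(_ y Ay)/exists_inP[s Hs /andP[sA /eqP sxy]] := h x Ax.
  by exists s.
apply/forall_inP=> y Ay; have [s [Hs sA sxy]] := h x y Ax Ay.
by apply/exists_inP; exists s => //; rewrite sA sxy eqxx.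
Qed.

Lemma rigid_transS (T : finType) (H K : {set {perm T}}) (A : {set T}) :
  H \subset K -> rigid_trans H A -> rigid_trans K A.
Proof.
move=> /subsetP sHK /rigid_transP h; apply/rigid_transP=> x y Ax Ay.
by have [s [/sHK Ks sA sxy]] := h x y Ax Ay; exists s.
Qed.

Lemma perm_onJ (T : finType) (A : {set T}) (s t : {perm T}) :
  perm_on A s -> perm_on (t @: A) (s ^ t).
Proof.
move=> sA; apply/subsetP=> x; rewrite inE -[x](permKV t) permJ.
move=> h; apply: imset_f; apply: contraNT h => nA.
by rewrite (out_perm sA nA).
Qed.

Lemma rigid_transJ (T : finType) (H : {set {perm T}}) (A : {set T}) (t : {perm T}) :
  rigid_trans H A -> rigid_trans (H :^ t) (t @: A).
Proof.
move=> /rigid_transP h; apply/rigid_transP=> _ _ /imsetP[x Ax ->] /imsetP[y Ay ->].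
have [s [Hs sA sxy]] := h x y Ax Ay; exists (s ^ t); split.
- by rewrite memJ_conjg.
- exact: perm_onJ.
by rewrite permJ sxy.
Qed.

(* The properties of a [k]-fold iterated wreath product of cyclic groups of
   order [p], acting on the leaves of the [p]-ary tree of depth [k], that the
   counting argument needs; [N] is the family of leaf sets of inner nodes. *)
Record wreath (p k : nat) (T : finType) (Y : {set T}) (G : {group {perm T}})
    (N : {set {set T}}) : Prop := Wreath {
  wreath_pgroup : p.-group G;
  wreath_supp : {in G, forall s, perm_on Y s};
  wreath_trans : {in Y &, forall x y, exists2 s, s \in G & s x = y};
  wreath_node : {in N, forall A : {set T}, A \subset Y /\ 1 < #|A|};
  wreath_laminar :
    {in N &, forall A B : {set T}, [\/ A \subset B, B \subset A | [disjoint A & B]]};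
  wreath_stable : {in G & N, forall (s : {perm T}) (A : {set T}), s @: A \in N};
  wreath_index (H : {group {perm T}}) : H \subset G ->
    (forall A, A \in N -> ~~ rigid_trans H A) -> p ^ k %| #|G : H| }.

Lemma wreathJ p k (T : finType) (Y : {set T}) G N (t : {perm T}) :
  wreath p k Y G N ->
  wreath p k (t @: Y) (G :^ t)%G [set t @: (A : {set T}) | A in N].
Proof.
case=> pG sG tG nN lN stN iN; split.
- by rewrite /= pgroupJ.
- by move=> _ /imsetP[s Gs ->]; apply/perm_onJ/sG.
- move=> _ _ /imsetP[x Yx ->] /imsetP[y Yy ->].
  have [s Gs sxy] := tG x y Yx Yy; exists (s ^ t); first by rewrite memJ_conjg.
  by rewrite permJ sxy.
- move=> _ /imsetP[A NA ->]; have [sAY cA] := nN A NA; split.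
    exact: imsetS.
  by rewrite card_imset //; exact: perm_inj.
- move=> _ _ /imsetP[A NA ->] /imsetP[B NB ->].
  have [sAB|sBA|dAB] := lN A B NA NB.
  + by apply: Or31; apply: imsetS.
  + by apply: Or32; apply: imsetS.
  apply: Or33; rewrite -setI_eq0 -imsetI; last by move=> x y _ _; apply: perm_inj.
  by rewrite imset_eq0 setI_eq0.
- move=> _ _ /imsetP[s Gs ->] /imsetP[A NA ->]; apply/imsetP.
  exists (s @: A); first exact: stN.
  rewrite -!imset_comp; apply: eq_imset => x /=.
  by rewrite permJ.
move=> H sHG nt; rewrite -[#|_ : _|](indexJg _ _ t^-1) /= conjsgK.
apply: iN => [|A NA].
  by rewrite sub_conjg invgK.
apply: contra (nt _ (imset_f _ NA)) => /(rigid_transJ t).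
by rewrite conjsgKV.
Qed.

(** Lagrange along [H], [H <*> K], [G] and the product formula for [H * K]. It allows divisibility
    of the index to be tested separately on the quotient and on the normal subgroup. *)
Lemma index_normal_split (gT : finGroupType) (G K H : {group gT}) :
  K <| G -> H \subset G -> #|G : H| = (#|G : H <*> K| * #|K : H :&: K|)%N.
Proof.
move=> nKG sHG; have [sKG nKG'] := andP nKG.
have HKE : H <*> K = H * K by rewrite norm_joinEl // (subset_trans sHG).
have sHKG : H <*> K \subset G by rewrite join_subG sHG.
rewrite -(Lagrange_index sHKG (joing_subl H K)); congr (_ * _)%N.
apply/eqP; rewrite -(eqn_pmul2l (cardG_gt0 H)) (Lagrange (joing_subl H K)) /= HKE.
rewrite -(eqn_pmul2r (cardG_gt0 (H :&: K))) /= -mul_cardG -mulnA; apply/eqP.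
by congr (_ * _)%N; rewrite mulnC Lagrange ?subsetIr.
Qed.

Lemma pgroup_index_dvd (gT : finGroupType) (p : nat) (G K : {group gT}) :
  p.-group G -> K \subset G -> ~~ (G \subset K) -> p %| #|G : K|.
Proof.
move=> pG sKG; rewrite -indexg_eq1 => ne1.
have /p_natP[[|e] ge] := pnat_dvd (dvdn_indexg G K) pG.
  by rewrite ge in ne1.
by rewrite ge expnS dvdn_mulr.
Qed.

Lemma astabs_setact (T : finType) (N : {set {set T}}) (s : {perm T}) :
  {in N, forall A : {set T}, s @: A \in N} -> s \in 'N(N | 'P^*).
Proof.
by move=> h; rewrite !inE /=; apply/subsetP=> A NA; rewrite inE; apply: h.
Qed.

(** The element [t] moves [p] copies of [Y0] cyclically; [b] reads off the copy of a point, which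
    makes the copies disjoint. The new group is the base group generated by the [p] commuting
    conjugates of [G0], extended by [t]; the new nodes are those of the copies and the root [Y]. *)
Lemma wreath_step p k (T : finType) (Y0 Y : {set T}) G0 N0 (t : {perm T})
    (b : T -> nat) :
    prime p -> wreath p k Y0 G0 N0 -> Y0 != set0 -> t ^+ p = 1 -> perm_on Y t ->
    (forall x i, x \in Y0 -> i < p -> b ((t ^+ i) x) = i) ->
    (forall y, y \in Y -> exists2 i, i < p & y \in (t ^+ i) @: Y0) ->
    (forall i, i < p -> (t ^+ i) @: Y0 \subset Y) ->
  exists G N, wreath p k.+1 Y G N.
Proof.
move=> p_pr wr0 nY0 tp tY bP coverY subY.
have p_gt0 := prime_gt0 p_pr.
pose Yi i := (t ^+ i) @: Y0; pose Gi i := (G0 :^ t ^+ i)%G.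
pose Ni i := [set (t ^+ i) @: (A : {set T}) | A in N0].
have wr i : wreath p k (Yi i) (Gi i) (Ni i) := wreathJ (t ^+ i) wr0.
have bY i x : i < p -> x \in Yi i -> b x = i.
  by move=> ltip /imsetP[y Yy ->]; apply: bP.
have disjY i j : i < p -> j < p -> i != j -> [disjoint Yi i & Yi j].
  move=> ltip ltjp nij; apply/pred0P=> x /=; apply/negP=> /andP[xi xj].
  by rewrite -(bY i x) // (bY j x) ?eqxx in nij.
pose B := <<\bigcup_(i < p) Gi i>>%G.
have sGiB i : i < p -> Gi i \subset B.
  move=> ltip; apply/sub_gen/(bigcup_sup (Ordinal ltip)) => //.
have nGi u : u < p -> Gi u <| B.
  move=> ltup; rewrite /normal sGiB // gen_subG; apply/bigcupsP=> i _.
  have [->|niu] := eqVneq (i : nat) u; first exact: normG.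
  apply: cents_norm; apply/centsP=> s Gs s' Gs'.
  exact: (perm_onC (wreath_supp (wr i) Gs) (wreath_supp (wr u) Gs') (disjY _ _ _ _ _)).
(* Every factor is a normal [p]-subgroup of [B], hence lies in the [p]-core. *)
have pB : p.-group B.
  apply: (pgroupS _ (pcore_pgroup p B)); rewrite gen_subG.
  apply/bigcupsP=> i _; apply: pcore_max; last exact: nGi.
  exact: wreath_pgroup (wr i).
have tB : <[t]> \subset 'N(B).
  rewrite cycle_subG inE -genJ gen_subG; apply/subsetP=> _ /imsetP[s + ->].
  case/bigcupP=> i _ Gs.
  have /subsetP -> // := sGiB _ (ltn_pmod i.+1 p_gt0).
  by rewrite /= (expg_mod _ tp) expgSr conjsgM memJ_conjg.
pose G := (B <*> <[t]>)%G.
have GE : G :=: B * <[t]> by rewrite /= norm_joinEr.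
have nBG : B <| G by rewrite /normal joing_subl join_subG normG.
have pG : p.-group G.
  rewrite GE pgroupM pB /= /pgroup -orderE; apply: (@pnat_dvd _ p).
    by rewrite order_dvdn tp.
  by rewrite pnat_id.
have suppB i s : i < p -> s \in Gi i -> perm_on Y s.
  move=> ltip Gs; apply: subset_trans (wreath_supp (wr i) Gs) _.
  exact: subY.
have suppG : {in G, forall s, perm_on Y s}.
  have: G \subset perm.Sym Y.
    rewrite join_subG gen_subG cycle_subG inE tY andbT.
    by apply/bigcupsP=> i _; apply/subsetP=> s Gs; rewrite inE (suppB i).
  by move/subsetP=> h s /h; rewrite inE.
have tG : t \in G by rewrite (subsetP (joing_subr _ _)) ?cycle_id.
have transG : {in Y &, forall x y, exists2 s, s \in G & s x = y}.
  move=> x y /coverY[i ltip /imsetP[x0 Yx0 ->]] /coverY[j ltjp /imsetP[y0 Yy0 ->]].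
  have [s Gs sxy] := wreath_trans wr0 Yx0 Yy0.
  exists ((t ^+ i)^-1 * s * t ^+ j).
    rewrite !groupM ?groupV ?groupX // (subsetP (joing_subl _ _)) //.
    have /subsetP-> // := sGiB _ p_gt0.
    by rewrite /= expg0 conjsg1.
  by rewrite !permM permK sxy.
pose N := Y |: \bigcup_(i < p) Ni i.
have NiN i A : i < p -> A \in Ni i -> A \in N.
  move=> ltip NA; rewrite inE; apply/orP; right; apply/bigcupP.
  by exists (Ordinal ltip).
have NP A : A \in N -> A = Y \/ exists2 i, i < p & A \in Ni i.
  by case/setU1P=> [->|/bigcupP[i _ NA]]; [left | right; exists i].
have nodeP i A : i < p -> A \in Ni i -> A \subset Y.
  by move=> /subY sY /(wreath_node (wr i))[sA _]; apply: subset_trans sA sY.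
exists G, N; split => //.
- move=> A /NP[->|[i ltip NA]]; last first.
    have [_ ?] := wreath_node (wr i) NA; split=> //; exact: nodeP NA.
  split=> //; have /set0Pn[x0 Yx0] := nY0.
  have lt1p := prime_gt1 p_pr.
  have x0Y : x0 \in Y.
    by apply: (subsetP (subY 0 p_gt0)); rewrite -[x0]perm1 imset_f.
  have x1Y : t x0 \in Y by rewrite perm_closed.
  apply: leq_trans (_ : #|[set x0; t x0]| <= _); last first.
    by apply: subset_leq_card; rewrite subUset !sub1set x0Y.
  rewrite cards2; case: eqVneq => // e.
  have := bP _ 1%N Yx0 lt1p; rewrite expg1 -e.
  by have := bP _ 0 Yx0 p_gt0; rewrite expg0 perm1 => ->.
- move=> A B' /NP[->|[i ltip NA]] /NP[->|[j ltjp NB]].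
  + by apply: Or31.
  + by apply: Or32; apply: nodeP NB.
  + by apply: Or31; apply: nodeP NA.
  have [eij|nij] := eqVneq i j.
    by rewrite -eij in NB; apply: wreath_laminar (wr i) _ _ NA NB.
  apply: Or33; have [sA _] := wreath_node (wr i) NA.
  have [sB _] := wreath_node (wr j) NB.
  exact: disjointWl sA (disjointWr sB (disjY _ _ ltip ltjp nij)).
- move=> s A Gs NA; case/NP: (NA) => [->|_].
    by rewrite (im_perm_on (suppG s Gs)) setU11.
  have: G \subset 'N(N | 'P^*).
    rewrite join_subG gen_subG cycle_subG; apply/andP; split.
      apply/bigcupsP=> i _; apply/subsetP=> g Gg; apply: astabs_setact => C.
      case/NP=> [->|[j ltjp NC]]; first by rewrite (im_perm_on (suppB i g _ Gg)) ?setU11.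
      have [eij|nij] := eqVneq (i : nat) j.
        apply: (NiN j) => //; rewrite -eij in NC *.
        exact: wreath_stable (wr i) _ _ Gg NC.
      suff -> : g @: C = C by apply: (NiN j).
      rewrite -[RHS]imset_id; apply: eq_in_imset => x Cx.
      apply: (out_perm (wreath_supp (wr i) Gg)).
      have [/subsetP sC _] := wreath_node (wr j) NC.
      by have /disjointFl-> := disjY _ _ (ltn_ord i) ltjp nij; last exact: sC.
    apply: astabs_setact => C /NP[->|[j ltjp /imsetP[C0 NC0 ->]]].
      by rewrite (im_perm_on tY) setU11.
    apply: (NiN (j.+1 %% p)); first exact: ltn_pmod.
    rewrite /Ni (expg_mod _ tp); apply/imsetP; exists C0 => //.
    by rewrite -imset_comp; apply: eq_imset => x /=; rewrite expgSr permM.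
  move/subsetP/(_ s Gs)=> sN.
  by rewrite -[_ @: _]/(('P^*)%act A s) (astabs_act _ sN).
move=> H sHG noRT.
have idx i : i < p -> p ^ k %| #|Gi i : H :&: Gi i|.
  move=> ltip; apply: (wreath_index (wr i) (subsetIr _ _)) => A NA.
  apply: contra (noRT A (NiN i A ltip NA)).
  by apply: rigid_transS; apply: subsetIl.
apply/negPn/negP=> ndvd.
(* The index of [H] is [p ^ k] times a power of [p], so this power is [1]:
   [H] covers [G] modulo [B], and [H :&: B] covers [B] modulo each factor. *)
have eG := index_normal_split nBG sHG.
have eB u : u < p -> #|B : H :&: B| =
    (#|B : (H :&: B) <*> Gi u| * #|Gi u : H :&: Gi u|)%N.
  move=> ltup; rewrite (index_normal_split (nGi u ltup) (subsetIr H B)).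
  by rewrite -setIA (setIidPr (sGiB _ ltup)).
have sBu u : u < p -> B \subset (H :&: B) <*> Gi u.
  move=> ltup; apply: contraNT ndvd => nsub.
  rewrite eG dvdn_mull // (eB u) // expnS dvdn_mul ?idx //.
  by apply: pgroup_index_dvd nsub => //; rewrite join_subG subsetIr sGiB.
have sGHB : G \subset H <*> B.
  apply: contraNT ndvd => nsub; rewrite eG expnS dvdn_mul //.
    by apply: pgroup_index_dvd nsub => //; rewrite join_subG sHG joing_subl.
  by rewrite (eB 0) // dvdn_mull // idx.
case/negP: (noRT Y (setU11 _ _)); apply/rigid_transP=> x y Yx Yy.
have [j ltjp Yjy] := coverY y Yy.
have closedB s z : s \in B -> (s z \in Yi j) = (z \in Yi j).
  move=> Bs; have: B \subset 'N(Yi j | 'P).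
    rewrite gen_subG; apply/bigcupsP=> i _; apply/subsetP=> g Gg.
    rewrite !inE /=; apply/subsetP=> w; rewrite !inE /= /aperm => Yw.
    have [eij|nij] := eqVneq (i : nat) j.
      by rewrite -eij in Yw *; rewrite (perm_closed _ (wreath_supp (wr i) Gg)).
    rewrite (out_perm (wreath_supp (wr i) Gg)) //.
    by have /disjointFl-> := disjY _ _ (ltn_ord i) ltjp nij.
  by move/subsetP/(_ s Bs)=> sN; rewrite -[s z]/(('P)%act z s) (astabs_act _ sN).
(* For another copy [u], the factor [Gi u] fixes [y]. Since [H :&: B] covers [B] modulo [Gi u], the
   element of [Gi j] that carries [h x] to [y] can be replaced by one of [H] with the same effect on
   [h x]. *)
have [u ltup nuj] : exists2 u, u < p & u != j.
  have lt1p := prime_gt1 p_pr.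
  by case: (eqVneq 0 j) => [<-|n0j]; [exists 1%N | exists 0%N].
have [g Gg gxy] := transG x y Yx Yy.
have nBH : H \subset 'N(B) by rewrite (subset_trans sHG) ?normal_norm.
have := subsetP sGHB g Gg; rewrite norm_joinEl // => /mulsgP[h s Hh Bs eg].
have hx : h x \in Yi j by rewrite -(closedB s) // -permM -eg gxy.
have [g' Gg' g'xy] := wreath_trans (wr j) hx Yjy.
have := subsetP (sBu u ltup) g' (subsetP (sGiB j ltjp) _ Gg').
rewrite norm_joinEl; last first.
  by rewrite (subset_trans (subsetIr _ _)) // normal_norm ?nGi.
case/mulsgP=> h' w /setIP[Hh' Bh'] Gw eg'.
have wy : w y = y.
  apply: (out_perm (wreath_supp (wr u) Gw)).
  by have /disjointFl-> := disjY _ _ ltup ltjp nuj.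
exists (h * h'); split; first exact: groupM.
  by apply: suppG; rewrite groupM // (subsetP sHG).
rewrite permM; apply: (@perm_inj _ w).
by rewrite wy -permM -eg'.
Qed.

Lemma wreath_exists p k n : prime p -> p ^ k <= n ->
  exists G N, wreath p k [set i : 'I_n | i < p ^ k] G N.
Proof.
move=> p_pr; have p_gt0 := prime_gt0 p_pr.
elim: k => [|k IHk] le_n.
  exists 1%G, set0; split => //.
  - exact: pgroup1.
  - by move=> s /set1P->; apply: perm_on1.
  - move=> x y; rewrite !inE expn0 !ltnS !leqn0 => /eqP x0 /eqP y0.
    by exists 1; rewrite ?group1 // perm1; apply: val_inj; rewrite /= x0 y0.
  - by move=> A; rewrite inE.
  - by move=> A B; rewrite inE.
  by move=> s A _; rewrite inE.
set d := (p ^ k)%N in IHk; set q := (p ^ k.+1)%N in le_n *.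
have d_gt0 : 0 < d by rewrite expn_gt0 p_gt0.
have qE : q = (p * d)%N by rewrite /q expnS.
have le_dq : d <= q by rewrite qE leq_pmull.
have q_gt0 : 0 < q by apply: leq_trans le_dq.
have [G0 [N0 wr0]] := IHk (leq_trans le_dq le_n).
(* [f] rotates the first [q] points by one block of length [d] and fixes the others; division by [d]
   gives the block number that [wreath_step] asks for. *)
pose f (i : 'I_n) : 'I_n := insubd i (if i < q then (i + d) %% q else i).
have fE i : f i = (if i < q then (i + d) %% q else i) :> nat.
  rewrite /f val_insubd; case: ifP => //; case: ifP => // _.
  by rewrite (leq_trans _ le_n) // ltn_pmod.
have iterE j i : iter j f i = (if i < q then (i + j * d) %% q else i) :> nat.
  elim: j => [|j IHj] /=; first by case: ifP => // iq; rewrite addn0 modn_small.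
  rewrite fE IHj; case: (ltnP i q) => iq; last by rewrite ltnNge iq.
  by rewrite ltn_pmod // modnDml -addnA addnC mulSn [(d + _)%N]addnC addnC.
have iterp i : iter p f i = i.
  apply: val_inj; rewrite /= iterE; case: ifP => // iq.
  by rewrite -qE modnDr modn_small.
have injf : injective f.
  apply: (can_inj (g := iter p.-1 f)) => i.
  by rewrite -iterSr prednK.
pose t := perm injf.
have tX j i : (t ^+ j) i = iter j f i.
  by rewrite permX; elim: j => //= j ->; rewrite permE.
apply: (@wreath_step p k _ _ _ G0 N0 t (fun i => i %/ d) p_pr wr0).
- apply/set0Pn; have n_gt0 : 0 < n by apply: leq_trans le_n.
  by exists (Ordinal n_gt0); rewrite inE.
- by apply/permP=> i; rewrite tX iterp perm1.
- apply/subsetP=> i; rewrite !inE permE; apply: contraNT; rewrite -leqNgt => le_qi.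
  by apply/eqP/val_inj; rewrite /= fE ltnNge le_qi.
- move=> x i; rewrite inE => xd ltip; rewrite tX iterE (leq_trans xd le_dq).
  rewrite modn_small; first by rewrite addnC divnMDl // divn_small ?addn0.
  rewrite qE; apply: (@leq_trans (i.+1 * d)); last by rewrite leq_mul2r ltip orbT.
  by rewrite mulSn ltn_add2r.
- move=> y; rewrite inE => yq; exists (y %/ d); first by rewrite ltn_divLR // -qE.
  have lt_n : y %% d < n by rewrite (leq_trans _ le_n) // (leq_trans _ le_dq) // ltn_pmod.
  apply/imsetP; exists (Ordinal lt_n); first by rewrite inE /= ltn_pmod.
  apply: val_inj; rewrite /= tX iterE /= (leq_trans _ le_dq) ?ltn_pmod //.
  by rewrite addnC -divn_eq modn_small.
move=> i ltip; apply/subsetP=> _ /imsetP[x + ->]; rewrite !inE => xd.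
by rewrite tX iterE (leq_trans xd le_dq) ltn_pmod.
Qed.

End Wreath.

(** * Counting relations by type *)

Import GRing.Theory.

(** Types ignore loops and everything outside [D], so relations are normalised to have neither. *)
Definition offdiag (T : finType) (D : {set T}) : {set T * T} :=
  [set z | [&& z.1 \in D, z.2 \in D & z.1 != z.2]].

Definition count_rel M q s (T : finType) (D : {set T}) (tau : T -> typ M q s)
    (th : typ M q s) : nat :=
  #|[set E : {set T * T} | (E \subset offdiag D) && (sum_typ D E tau == th)]|.

Lemma count_rel_inj M q s (T T' : finType) (f : T -> T') (D : {set T})
    (tau : T -> typ M q s) (tau' : T' -> typ M q s) th :
    {in D &, injective f} -> {in D, forall i, tau' (f i) = tau i} ->
  count_rel D tau th = count_rel (f @: D) tau' th.
Proof.
move=> injf eqt; rewrite /count_rel.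
pose h (E : {set T * T}) := [set (f z.1, f z.2) | z in E].
have memh (E : {set T * T}) i j : E \subset offdiag D -> i \in D -> j \in D ->
    ((f i, f j) \in h E) = ((i, j) \in E).
  move=> /subsetP sE Di Dj; apply/imsetP/idP => [[[i' j'] /= Eij []]|Eij].
    have := sE _ Eij; rewrite inE /= => /and3P[Di' Dj' _] fi fj.
    by rewrite (injf _ _ Di Di' fi) (injf _ _ Dj Dj' fj).
  by exists (i, j).
have compE (E : {set T * T}) : E \subset offdiag D ->
    sum_typ D E tau = sum_typ (f @: D) (h E) tau'.
  by move=> sE; apply: sum_typ_inj => // i j Di Dj _; rewrite memh.
rewrite -(card_in_imset (f := h)); last first.
  move=> E E'; rewrite !inE => /andP[sE _] /andP[sE' _] eqh.
  apply/setP=> -[i j].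
  have [/and3P[/= Di Dj _]|nD] := boolP [&& i \in D, j \in D & i != j].
    by rewrite -memh // eqh memh.
  have nE (E0 : {set T * T}) : E0 \subset offdiag D -> (i, j) \notin E0.
    by move/subsetP/(_ (i, j))=> h0; apply: contra nD => /h0; rewrite inE.
  by rewrite (negPf (nE _ sE)) (negPf (nE _ sE')).
apply: eq_card => E'; rewrite inE; apply/imsetP/andP.
  case=> E; rewrite inE => /andP[sE /eqP ecomp] ->; split.
    apply/subsetP=> _ /imsetP[[i j] Eij ->].
    have := subsetP sE _ Eij; rewrite !inE /= => /and3P[Di Dj nij].
    by rewrite !imset_f //=; apply: contraNneq nij => /(injf _ _ Di Dj)->.
  by rewrite -compE // ecomp.
case=> sE' ecomp; pose E := [set z in offdiag D | (f z.1, f z.2) \in E'].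
have sE : E \subset offdiag D by apply/subsetP=> z; rewrite inE => /andP[].
have EE' : E' = h E.
  apply/setP=> -[y z]; apply/idP/imsetP => [Eyz|[[i j] + ->]].
    have := subsetP sE' _ Eyz; rewrite inE /= => /and3P[/imsetP[i Di yi]].
    case/imsetP=> j Dj zj nyz; exists (i, j); last by rewrite yi zj.
    rewrite !inE /= Di Dj -yi -zj Eyz andbT /=.
    by apply: contraNneq nyz => eij; rewrite yi zj eij.
  by rewrite inE => /andP[].
by exists E => //; rewrite inE sE /= compE // -EE'.
Qed.

(** The count depends only on the multiset of letters. Words make families over different index
    types comparable and let letters be appended. *)
Definition count_seq M q s (w : seq (typ M q s)) (th : typ M q s) : nat :=
  count_rel [set: 'I_(size w)] (tnth (in_tuple w)) th.

Lemma count_rel_seq M q s (T : finType) (D : {set T}) (tau : T -> typ M q s) w th :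
  perm_eq [seq tau i | i <- enum D] w -> count_rel D tau th = count_seq w th.
Proof.
set e := enum D => eq_w.
have [f [injf fD ftau]] : exists f : 'I_(size w) -> T,
    [/\ injective f, f @: [set: _] = D & forall i, tau (f i) = tnth (in_tuple w) i].
  have szw : size w = size e by rewrite -(perm_size eq_w) size_map.
  case: (posnP (size w)) => [w0|w_gt0].
    have nI (i : 'I_(size w)) : False by case: i => i; rewrite w0.
    exists (fun i => match nI i with end); split; try by move=> i; case: (nI i).
    have -> : D = set0.
      by apply/setP=> x; rewrite -mem_enum -/e inE (size0nil (esym (etrans (esym w0) szw))).
    by apply/setP=> x; rewrite inE; apply/imsetP=> -[i]; case: (nI i).
  have x0 : T by case: (e) szw w_gt0 => [->|x].
  pose y0 := tau x0.
  have := eq_w; rewrite perm_sym => /(perm_iotaP y0)[Is pIs wE].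
  have szI : size Is = size e by rewrite (perm_size pIs) size_iota size_map.
  have ltI i : i < size w -> nth 0 Is i < size e.
    move=> lti; have : nth 0 Is i \in Is by rewrite mem_nth // szI -szw.
    by rewrite (perm_mem pIs) mem_iota add0n size_map.
  have uIs : uniq Is by rewrite (perm_uniq pIs) iota_uniq.
  exists (fun i : 'I__ => nth x0 e (nth 0 Is i)); split.
  - move=> i j /eqP; rewrite nth_uniq ?enum_uniq ?ltI // => /eqP eIs.
    have: (i : nat) == j by rewrite -(nth_uniq 0 _ _ uIs) ?szI -?szw // eIs.
    by move/eqP/val_inj.
  - apply/setP=> x; rewrite -[RHS]mem_enum -/e; apply/imsetP/idP => [[i _ ->]|ex].
      by rewrite mem_nth ?ltI.
    have ltx : index x e < size e by rewrite index_mem.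
    have inI : index x e \in Is by rewrite (perm_mem pIs) mem_iota add0n size_map.
    have lti : index (index x e) Is < size w by rewrite szw -szI index_mem.
    by exists (Ordinal lti) => //=; rewrite !nth_index.
  move=> i; rewrite (tnth_nth y0) /= {2}wE (nth_map 0) ?szI -?szw //.
  by rewrite (nth_map x0) // ltI.
rewrite /count_seq (count_rel_inj (f := f) (tau' := tau)) ?fD //.
by move=> i j _ _; apply: injf.
Qed.

Lemma count_seq_perm M q s (w w' : seq (typ M q s)) th :
  perm_eq w w' -> count_seq w th = count_seq w' th.
Proof.
move=> eq_w; rewrite {1}/count_seq; apply: count_rel_seq.
by rewrite enum_setT -enumT map_tnth_enum.
Qed.

(** For each [x], expand the product over [i] of [1 - P i x]. *)
Lemma card_incl_excl (I U : finType) (X : {set U}) (P : I -> pred U) :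
  (#|[set x in X | [forall i, ~~ P i x]]|%:Z =
   \sum_(V : {set I}) (-1) ^+ #|V| * #|[set x in X | [forall i in V, P i x]]|%:Z)%R.
Proof.
have cardE (Q : pred U) : (#|[set x in X | Q x]|%:Z = \sum_(x in X) (Q x)%:Z)%R.
  transitivity (Posz (\sum_(x in X) Q x)).
    congr Posz; rewrite -sum1_card big_mkcond [RHS]big_mkcond.
    by apply: eq_bigr => x _; rewrite inE; case: (x \in X) => //; case: (Q x).
  by rewrite -natz natr_sum; apply: eq_bigr => x _; rewrite natz.
rewrite cardE; under [RHS]eq_bigr do rewrite cardE big_distrr /=.
rewrite exchange_big /=; apply: eq_bigr => x _.
transitivity (\prod_(i : I) ((- (P i x)%:Z) + 1) : int)%R.
  have [/forallP h|] := boolP [forall i, ~~ P i x].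
    by rewrite big1 // => i _; rewrite (negPf (h i)).
  rewrite negb_forall => /existsP[i]; rewrite negbK => Pi.
  by rewrite (bigD1 i) //= Pi /= mul0r.
rewrite bigA_distr; apply: eq_bigr => V _.
have [/forall_inP h|] := boolP [forall i in V, P i x].
  rewrite mulr1 -prodr_const [RHS]big_mkcond /=; apply: eq_bigr => i _.
  by case: ifP => // /h ->.
rewrite negb_forall => /existsP[i]; rewrite negb_imply => /andP[Vi nPi].
by rewrite (bigD1 i) //= Vi (negPf nPi) oppr0 mul0r mulr0.
Qed.

Definition preserves (T : finType) (f : T -> T) (E : {set T * T}) : bool :=
  [forall x, forall y, ((f x, f y) \in E) == ((x, y) \in E)].

Lemma preservesP (T : finType) (f : T -> T) (E : {set T * T}) :
  reflect (forall x y, ((f x, f y) \in E) = ((x, y) \in E)) (preserves f E).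
Proof.
apply: (iffP forallP) => [h x y|h x]; first by have /forallP/(_ y)/eqP := h x.
by apply/forallP=> y; rewrite h.
Qed.

(** * Permutations of equal letters *)

Section LeafAction.

Variables (L J : finType).
Local Notation T := (L + J)%type.

(** [L] holds the positions of a repeated letter, [J] those of the remaining letters, which never
    move. *)
Definition leaf_map (f : L -> L) (x : T) : T :=
  match x with inl i => inl (f i) | inr j => inr j end.

Lemma leaf_map1 x : leaf_map (1%g : {perm L}) x = x.
Proof. by case: x => //= i; rewrite perm1. Qed.

Lemma leaf_mapM (s t : {perm L}) x :
  leaf_map (s * t)%g x = leaf_map t (leaf_map s x).
Proof. by case: x => //= i; rewrite permM. Qed.

Lemma leaf_mapK (s : {perm L}) : cancel (leaf_map s) (leaf_map s^-1%g).
Proof. by move=> x; rewrite -leaf_mapM mulgV leaf_map1. Qed.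

Lemma leaf_mapKV (s : {perm L}) : cancel (leaf_map s^-1%g) (leaf_map s).
Proof. by move=> x; rewrite -leaf_mapM mulVg leaf_map1. Qed.

Definition leaf_act (E : {set T * T}) (s : {perm L}) : {set T * T} :=
  [set z | (leaf_map s^-1%g z.1, leaf_map s^-1%g z.2) \in E].

Lemma leaf_act1 E : leaf_act E 1%g = E.
Proof. by apply/setP=> -[x y]; rewrite inE invg1 !leaf_map1. Qed.

Lemma leaf_actM E : act_morph leaf_act E.
Proof. by move=> s t; apply/setP=> -[x y]; rewrite !inE /= invMg !leaf_mapM. Qed.

Canonical leaf_action := TotalAction leaf_act1 leaf_actM.

Lemma leaf_act_stab E s : (s \in ('C[E | leaf_action])%g) = preserves (leaf_map s) E.
Proof.
rewrite -[s \in _]groupV; apply/astab1P/preservesP => [eE x y|h].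
  by rewrite -[in RHS]eE inE invgK.
by apply/setP=> -[x y]; rewrite inE invgK h.
Qed.

Lemma leaf_act_sum M q s (tau : T -> typ M q s) (E : {set T * T}) g th0 :
    (forall i, tau (inl i) = th0) ->
  sum_typ setT (leaf_act E g) tau = sum_typ setT E tau.
Proof.
move=> tauL; have eT : leaf_map g @: [set: T] = [set: T].
  apply/setP=> x; rewrite inE; apply/imsetP.
  by exists (leaf_map g^-1%g x); rewrite ?leaf_mapKV.
rewrite -{1}eT; apply/esym/sum_typ_inj.
- by move=> x y _ _; apply: can_inj (leaf_mapK g) _ _.
- by move=> x y _ _ _; rewrite inE /= !leaf_mapK.
by case=> //= i; rewrite !tauL.
Qed.

End LeafAction.

(** * The equivalence relation of a laminar family *)

Section Classes.

Variables (L : finType) (V : {set {set L}}).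

(** Laminarity makes this transitive: of two members of [V] with a common point, one contains the
    other. The classes with more than one point are then maximal members of [V]. *)
Definition same_node (i j : L) : bool :=
  (i == j) || [exists A in V, (i \in A) && (j \in A)].

Definition node_class (i : L) : {set L} := [set j | same_node i j].

(** Picked from the class as a set, so equivalent points get the same representative; the default
    [i] is never reached, as the class contains [i]. *)
Definition node_rep (i : L) : L := odflt i [pick j in node_class i].

Hypothesis laminarV :
  {in V &, forall A B : {set L}, [\/ A \subset B, B \subset A | [disjoint A & B]]}.

Lemma same_node_refl i : same_node i i.
Proof. by rewrite /same_node eqxx. Qed.

Lemma same_node_sym i j : same_node i j = same_node j i.
Proof.
rewrite /same_node eq_sym; congr (_ || _).
by apply: eq_existsb => A; rewrite [(i \in A) && _]andbC.
Qed.

Lemma same_node_trans i j l : same_node i j -> same_node j l -> same_node i l.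
Proof.
case/orP=> [/eqP-> //|/exists_inP[A VA /andP[Ai Aj]]].
case/orP=> [/eqP <-|/exists_inP[B VB /andP[Bj Bl]]].
  by apply/orP; right; apply/exists_inP; exists A; rewrite ?Ai.
apply/orP; right; apply/exists_inP.
have [sAB|sBA|dAB] := laminarV VA VB.
- by exists B; rewrite // (subsetP sAB) //.
- by exists A; rewrite // Ai (subsetP sBA).
by have := disjointFr dAB Aj; rewrite Bj.
Qed.

Lemma node_class_eq i j : same_node i j -> node_class i = node_class j.
Proof.
move=> ij; apply/setP=> l; rewrite !inE; apply/idP/idP.
  by apply: same_node_trans; rewrite same_node_sym.
exact: same_node_trans.
Qed.

Lemma same_node_rep i : same_node i (node_rep i).
Proof.
rewrite /node_rep; case: pickP => [j|/(_ i)] /=; rewrite inE //.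
by rewrite same_node_refl.
Qed.

Lemma node_rep_eq i j : (node_rep i == node_rep j) = same_node i j.
Proof.
apply/eqP/idP => [e|ij].
  apply: same_node_trans (same_node_rep i) _.
  by rewrite e same_node_sym same_node_rep.
rewrite /node_rep (node_class_eq ij); case: pickP => // /(_ j).
by rewrite inE same_node_refl.
Qed.

Lemma node_rep_id i : node_rep (node_rep i) = node_rep i.
Proof. by apply/eqP; rewrite node_rep_eq same_node_sym same_node_rep. Qed.

End Classes.

(** * Contracting rigid nodes *)

Section Quotient.

Variables (M q s p k : nat) (L J : finType).
Variables (G : {group {perm L}}) (N V : {set {set L}}).
Hypothesis wr : wreath p k [set: L] G N.
Hypothesis sVN : V \subset N.
Variable th0 : typ M q s.
Variable tau : L + J -> typ M q s.
Hypothesis tauL : forall i, tau (inl i) = th0.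

Local Notation T := (L + J)%type.
Local Notation sim := (same_node V).
Local Notation cls := (node_class V).
Local Notation rep := (node_rep V).
Local Notation R := (leaf_map (J := J) rep).

Let lamV :
  {in V &, forall A B : {set L}, [\/ A \subset B, B \subset A | [disjoint A & B]]}.
Proof. by move=> A B /(subsetP sVN) NA /(subsetP sVN) NB; apply: wreath_laminar wr _ _ NA NB. Qed.

Definition rigid_at (A : {set L}) (E : {set T * T}) : bool :=
  rigid_trans [set g in G | preserves (leaf_map (J := J) g) E] A.

(** The possible traces, inside the classes, of a relation that is rigid at every node of [V]; by
    [uniform_rigid] rigidity is a condition on the trace alone. *)
Definition inner (e : {set L * L}) : bool :=
  (e \subset [set z | sim z.1 z.2 && (z.1 != z.2)]) &&
  [forall A in V, rigid_trans [set g in G | preserves (g : {perm L}) e] A].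

Definition inner_part (E : {set T * T}) : {set L * L} :=
  [set z | sim z.1 z.2 && ((inl z.1, inl z.2) \in E)].

(** Every class is a module of [E]: points outside do not distinguish its points. *)
Definition uniform (E : {set T * T}) : Prop :=
  forall x y, R x != R y -> ((x, y) \in E) = ((R x, R y) \in E).

Lemma rep_map_id x : R (R x) = R x.
Proof. by case: x => //= i; rewrite (node_rep_id lamV). Qed.

Lemma rep_map_inl i j : (R (inl i) == R (inl j)) = sim i j.
Proof. by rewrite -(node_rep_eq lamV). Qed.

Lemma perm_on_sim A (g : {perm L}) i j :
  A \in V -> perm_on A g -> sim (g i) (g j) = sim i j.
Proof.
move=> VA gA.
have sim_g l : sim l (g l).
  have [Al|nAl] := boolP (l \in A); last by rewrite (out_perm gA nAl) same_node_refl.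
  apply/orP; right; apply/exists_inP; exists A => //.
  by rewrite Al perm_closed.
apply/idP/idP => h.
  apply: (same_node_trans lamV (sim_g i)); apply: (same_node_trans lamV h).
  by rewrite same_node_sym.
rewrite same_node_sym; apply: (same_node_trans lamV _ (sim_g i)).
by rewrite same_node_sym in h; apply: (same_node_trans lamV _ h); rewrite same_node_sym.
Qed.

Lemma perm_on_rep A (g : {perm L}) x :
  A \in V -> perm_on A g -> R (leaf_map g x) = R x.
Proof.
case: x => //= i VA gA; congr inl; apply/eqP; rewrite (node_rep_eq lamV).
have [Ai|nAi] := boolP (i \in A); last by rewrite (out_perm gA nAi) same_node_refl.
apply/orP; right; apply/exists_inP; exists A => //.
by rewrite Ai perm_closed // Ai.
Qed.

(** A permutation supported on a node [A] fixes each point outside, so such a point is related in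
    the same way to all points of [A]. Endpoints are replaced by their representatives one at a
    time. *)
Lemma rigid_uniform E : {in V, forall A, rigid_at A E} -> uniform E.
Proof.
move=> rE.
have step i j y : sim i j -> R (inl i) != R y ->
   ((inl i, y) \in E) = ((inl j, y) \in E) /\ ((y, inl i) \in E) = ((y, inl j) \in E).
  case/orP=> [/eqP-> //|/exists_inP[A VA /andP[Ai Aj]]] ny.
  have /rigid_transP/(_ i j Ai Aj)[g []] := rE A VA.
  rewrite inE => /andP[_ /preservesP gE] gA gij.
  have gy : leaf_map g y = y.
    case: y ny => //= l; rewrite -[inl _]/(R (inl i)) rep_map_inl => nl.
    rewrite (out_perm gA) //; apply: contraNN nl => Al.
    by apply/orP; right; apply/exists_inP; exists A; rewrite ?Ai.
  by rewrite -gE -[in RHS]gij -[(y, _) \in E]gE /= gy gij.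
move=> x y nxy.
have e1 : ((x, y) \in E) = ((R x, y) \in E).
  case: x nxy => //= i nxy; have [-> //] := step i (rep i) y (same_node_rep _ _) nxy.
have nyx : R y != R (R x) by rewrite rep_map_id eq_sym.
rewrite e1; case: y nyx {nxy e1} => //= j nyx.
by have [_ ->] := step j (rep j) (R x) (same_node_rep _ _) nyx.
Qed.

(** A permutation supported on [A] keeps each class in place, so by uniformity it preserves the
    edges between classes; only edges inside classes remain to be checked. *)
Lemma uniform_rigid E A : uniform E -> A \in V ->
  rigid_at A E = rigid_trans [set g in G | preserves (g : {perm L}) (inner_part E)] A.
Proof.
move=> uE VA.
have pres (g : {perm L}) : perm_on A g ->
    preserves (leaf_map (J := J) g) E = preserves g (inner_part E).
  move=> gA; apply/preservesP/preservesP => h.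
    by move=> i j; rewrite !inE /= (perm_on_sim _ _ VA gA) -[_ \in E in RHS]h.
  move=> x y; have [exy|nxy] := eqVneq (R x) (R y); last first.
    by rewrite uE ?(perm_on_rep _ VA gA) // -uE.
  case: x y exy => [i|i] [j|j] //= [/eqP]; rewrite (node_rep_eq lamV) => ij.
  by have := h i j; rewrite !inE /= (perm_on_sim _ _ VA gA) ij.
apply/rigid_transP/rigid_transP => h x y Ax Ay; have [g []] := h x y Ax Ay;
  by rewrite inE => /andP[Gg gE] gA gxy; exists g; rewrite inE Gg ?pres // -?pres.
Qed.

Definition rep_set : {set T} := [set x | R x == x].

(** A representative carries its whole class as one letter, the sum along [e] of the copies of [th0]
    in the class. *)
Definition rep_typ (e : {set L * L}) (x : T) : typ M q s :=
  match x with
  | inl i => sum_typ (cls i) e (fun=> th0)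
  | inr j => tau (inr j)
  end.

(** Rebuilds a uniform relation from its inner part and its edges between representatives. The
    default [false] is met only at loops on [J]. *)
Definition glue (e : {set L * L}) (E' : {set T * T}) : {set T * T} :=
  [set z | if R z.1 == R z.2 then
             match z with (inl i, inl j) => (i, j) \in e | _ => false end
           else (R z.1, R z.2) \in E'].

Lemma rep_mapS : R @: [set: T] = rep_set.
Proof.
apply/setP=> x; rewrite inE; apply/imsetP/eqP => [[y _ ->]|<-].
  exact: rep_map_id.
by exists x.
Qed.

Lemma glue_off e E' x y : R x != R y ->
  ((x, y) \in glue e E') = ((R x, R y) \in E').
Proof. by rewrite inE /= => /negPf->. Qed.

Lemma glue_in e E' i j : sim i j ->
  ((inl i, inl j) \in glue e E') = ((i, j) \in e).
Proof. by rewrite inE -rep_map_inl => ->. Qed.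

Lemma glue_sum e E' :
  sum_typ setT (glue e E') tau = sum_typ rep_set E' (rep_typ e).
Proof.
rewrite -rep_mapS; apply: sum_typ_fiber => [x y _ _ nxy|x _].
  exact: glue_off.
case: x => [i|j] /=.
  have -> : [set y in [set: T] | R y == inl (rep i)] = inl @: cls i.
    apply/setP=> y; rewrite !inE; apply/idP/imsetP => [|[j]].
      case: y => //= j; rewrite -[inl (rep i)]/(R (inl i)) -[inl (rep j)]/(R (inl j)).
      by rewrite rep_map_inl same_node_sym => ij; exists j; rewrite ?inE.
    by rewrite inE => ij ->; rewrite -[inl (rep i)]/(R (inl i)) rep_map_inl same_node_sym.
  rewrite -(node_class_eq lamV (same_node_rep V i)).
  apply: sum_typ_inj => [? ? _ _ []//|a b ia ib _|a _]; last by rewrite tauL.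
  rewrite inE in ia; rewrite inE in ib; rewrite glue_in //.
  by apply: (same_node_trans lamV _ ib); rewrite same_node_sym.
have -> : [set y in [set: T] | R y == inr j] = [set inr j].
  by apply/setP=> -[i|j']; rewrite !inE.
by rewrite sum_typ_set1.
Qed.

(** Once the inner part is fixed, a uniform relation is determined by its restriction to the
    representatives; [glue e] inverts the restriction, and [glue_sum] keeps track of the type. *)
Lemma card_uniform_inner (e : {set L * L}) th (U : {set {set T * T}}) :
    inner e ->
    (forall E : {set T * T}, reflect [/\ E \subset offdiag setT, sum_typ setT E tau = th,
                           uniform E & inner_part E = e] (E \in U)) ->
  #|U| = count_rel rep_set (rep_typ e) th.
Proof.
case/andP=> /subsetP se _ UP; rewrite /count_rel.
have restr E' z : z \in offdiag rep_set -> (z \in glue e E') = (z \in E').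
  case: z => x y zO.
  have /and3P[/eqP ex /eqP ey nxy] : [&& R x == x, R y == y & x != y].
    by move: zO; rewrite !inE.
  by rewrite glue_off ?ex ?ey.
rewrite -[RHS](card_in_imset (f := glue e)); last first.
  move=> E1 E2; rewrite !inE => /andP[/subsetP s1 _] /andP[/subsetP s2 _] eqg.
  apply/setP=> z; apply/idP/idP => Ez.
    by rewrite -restr ?s1 // -eqg restr ?s1.
  by rewrite -restr ?s2 // eqg restr ?s2.
apply: eq_card => E; apply/UP/imsetP => [[sE eth uE eE]|[E' + ->]].
  have EE : E = glue e (E :&: offdiag rep_set).
    apply/setP=> -[x y]; have [exy|nxy] := eqVneq (R x) (R y); last first.
      rewrite glue_off // uE // in_setI.
      have -> : (R x, R y) \in offdiag rep_set; last by rewrite andbT.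
      by rewrite !inE !rep_map_id !eqxx.
    rewrite inE /= exy eqxx; case: x y exy => [i|i] [j|j] //= [].
      by move/eqP; rewrite (node_rep_eq lamV) -eE inE /= => ->.
    move=> ->; apply/negP=> /(subsetP sE).
    by rewrite inE /= eqxx !andbF.
  exists (E :&: offdiag rep_set) => //.
  by rewrite inE subsetIr /= -glue_sum -EE eth.
rewrite inE => /andP[sE' /eqP eth]; split.
- apply/subsetP=> -[x y]; rewrite !inE /=; apply: contraTneq => <-.
  rewrite eqxx; case: x => //= i; apply/negP=> /se.
  by rewrite inE /= eqxx andbF.
- by rewrite glue_sum.
- by move=> x y nxy; rewrite !glue_off ?rep_map_id.
apply/setP=> -[i j]; rewrite inE /=; have [ij|nij] := boolP (sim i j).
  by rewrite glue_in.
by apply/esym/negP=> /se; rewrite inE /= (negPf nij).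
Qed.

End Quotient.

(** * Reduction to shorter words *)

Lemma enum_sumT (L J : finType) :
  enum {: L + J} = [seq inl i | i <- enum L] ++ [seq inr j | j <- enum J].
Proof. by rewrite !enumT {1}unlock. Qed.

Lemma enum_sum_set (L J : finType) (D : {set L + J}) :
  enum D = [seq inl i | i <- enum L & inl i \in D] ++
           [seq inr j | j <- enum J & inr j \in D].
Proof.
by rewrite /enum_mem -enumT enum_sumT filter_cat !filter_map.
Qed.

(** The relations without rigid node are closed under [G], since [G] permutes the nodes. Each orbit
    has the index of a stabiliser as its size, and [wreath_index] applies to that stabiliser. *)
Lemma card_no_rigid_dvd p k (L J : finType) (G : {group {perm L}}) N
    (X : {set {set (L + J) * (L + J)}}) :
    wreath p k [set: L] G N ->
    (forall E g, g \in G -> E \in X -> leaf_act E g \in X) ->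
  p ^ k %| #|[set E in X | [forall A, ~~ ((A \in N) && rigid_at G A E)]]|.
Proof.
move=> wr actX; set X0 := [set E in X | _].
have stabE E : [set g in G | preserves (leaf_map (J := J) g) E] =
    ('C_G[E | leaf_action L J])%g.
  by apply/setP=> g; rewrite !inE -leaf_act_stab !inE.
have actX0 : [acts G, on X0 | leaf_action L J].
  apply/subsetP=> g Gg; rewrite !inE /=; apply/subsetP=> E.
  rewrite !inE => /andP[XE /forallP nE]; rewrite actX //=.
  apply/forallP=> A; apply: contra (nE (g^-1%g @: A)) => /andP[NA].
  rewrite /rigid_at !stabE => rA.
  rewrite (wreath_stable wr) ?groupV //=.
  have := rigid_transJ g^-1%g rA.
  rewrite -[leaf_act E g]/((leaf_action L J) E g) astab1_act conjIg conjsgK.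
  by rewrite (normP _) // groupV (subsetP (normG G)).
rewrite -(acts_sum_card_orbit actX0); apply: dvdn_sum => O /imsetP[E X0E ->].
rewrite card_orbit; apply: (wreath_index wr); first exact: subsetIl.
move=> A NA; move: X0E; rewrite !inE => /andP[_ /forallP/(_ A)].
by rewrite NA /= /rigid_at stabE.
Qed.

Section Reduce.

Variables (M q s p k : nat) (th0 : typ M q s).
Hypothesis p_pr : prime p.

(** Rigidity at all of [V] forces uniformity; the relations are then sorted by their trace inside
    the classes. *)
Lemma card_rigid_family (L J : finType) (G : {group {perm L}})
    (N V : {set {set L}}) (tau : L + J -> typ M q s) th :
    wreath p k [set: L] G N -> V \subset N -> (forall i, tau (inl i) = th0) ->
  #|[set E : {set (L + J) * (L + J)} |
      (E \subset offdiag setT) && (sum_typ setT E tau == th) &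
      [forall A in V, (A \in N) && rigid_at G A E]]| =
  \sum_(e | inner G V e) count_rel (rep_set J V) (rep_typ V th0 tau e) th.
Proof.
move=> wr sVN tauL; set X := [set E | _ & _].
have XP (E : {set (L + J) * (L + J)}) : E \in X ->
    [/\ E \subset offdiag setT, sum_typ setT E tau = th, uniform V E &
        inner G V (inner_part V E)].
  rewrite !inE => /andP[/andP[sE /eqP eth] /forall_inP rE].
  have rE' : {in V, forall A, rigid_at G A E} by move=> A /rE /andP[].
  have uE := rigid_uniform wr sVN rE'; split=> //; apply/andP; split.
    apply/subsetP=> -[i j]; rewrite !inE /= => /andP[-> /(subsetP sE)].
    by rewrite !inE /= => h; apply: contraNneq h => ->.
  by apply/forall_inP=> A VA; rewrite -(uniform_rigid wr sVN uE VA) rE'.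
rewrite -sum1_card (partition_big (inner_part V) (inner G V)) /=; last first.
  by move=> E /XP[].
apply: eq_bigr => e ie.
rewrite -(@card_uniform_inner M q s p k L J G N V wr sVN th0 tau tauL e th
  [set E in X | inner_part V E == e] ie).
  by rewrite -sum1_card; apply: eq_bigl => E; rewrite !inE.
move=> E; apply: (iffP idP) => [|[sE eth uE eE]].
  by rewrite inE => /andP[/XP[? ? ? _] /eqP].
rewrite !inE sE eth eE !eqxx /= andbT; apply/forall_inP=> A VA.
rewrite (subsetP sVN) //= (uniform_rigid wr sVN uE VA) eE.
by case/andP: ie => _ /forall_inP->.
Qed.

(** Relations without rigid node contribute a multiple of [p ^ k]; in the inclusion-exclusion
    formula each nonempty family [V] of nodes contracts its classes to single letters. The
    coefficients and the words [dl i] are chosen before [v] and [th], so different suffixes [v] obey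
    the same recurrence. *)
Theorem count_seq_reduce :
  exists (I : finType) (ok : pred I) (c : I -> int) (dl : I -> seq (typ M q s)),
    (forall i, ok i -> size (dl i) < p ^ k) /\
    forall v th,
      ((p ^ k)%:Z %| (count_seq (nseq (p ^ k) th0 ++ v) th)%:Z -
         \sum_(i | ok i) c i * (count_seq (dl i ++ v) th)%:Z)%Z%R.
Proof.
have [L [cL [G [N wr]]]] :
    exists L : finType, #|L| = p ^ k /\ exists G N, wreath p k [set: L] G N.
  have [G [N wr]] := wreath_exists p_pr (leqnn (p ^ k)).
  exists 'I_(p ^ k); split; [exact: card_ord | exists G, N].
  suff <- : [set i : 'I_(p ^ k) | i < p ^ k] = setT by [].
  by apply/setP=> i; rewrite !inE ltn_ord.
pose dl (j : {set {set L}} * {set L * L}) :=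
  [seq sum_typ (node_class j.1 i) j.2 (fun=> th0) | i <- enum L & node_rep j.1 i == i].
exists ({set {set L}} * {set L * L})%type.
exists (fun j => (j.1 != set0) && (j.1 \subset N) && inner G j.1 j.2).
exists (fun j : {set {set L}} * {set L * L} => (- (-1) ^+ #|j.1|)%R), dl.
split=> [[V e] /= /andP[/andP[/set0Pn[A VA] sVN] _]|v th].
  have NA := subsetP sVN A VA; have [_ /card_gt1P[x [y [Ax Ay nxy]]]] := wreath_node wr NA.
  have lam : {in V &, forall A B : {set L},
      [\/ A \subset B, B \subset A | [disjoint A & B]]}.
    by move=> B C /(subsetP sVN) NB /(subsetP sVN) NC; apply: wreath_laminar wr _ _ NB NC.
  rewrite /dl /= size_map size_filter -cL cardE.
  rewrite -(count_predC (fun i => node_rep V i == i) (enum L)).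
  rewrite -[X in X < _]addn0 ltn_add2l -has_count; apply/hasP.
  (* Two points of a node share their representative, so they cannot both represent themselves: at
     least one letter is lost. *)
  have: ~~ ((node_rep V x == x) && (node_rep V y == y)).
    apply: contraNN nxy => /andP[/eqP <- /eqP <-]; rewrite (node_rep_eq lam).
    by apply/orP; right; apply/exists_inP; exists A; rewrite ?Ax.
  rewrite negb_and => /orP[h|h]; first by exists x; rewrite ?mem_enum.
  by exists y; rewrite ?mem_enum.
pose J : finType := 'I_(size v).
pose tau (x : L + J) := match x with inl _ => th0 | inr j => tnth (in_tuple v) j end.
have tauL i : tau (inl i) = th0 by [].
have enumJ : [seq tnth (in_tuple v) j | j <- enum J] = v by rewrite map_tnth_enum.
have <- : count_rel [set: L + J] tau th = count_seq (nseq (p ^ k) th0 ++ v) th.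
  apply: count_rel_seq; rewrite enum_sum_set map_cat -!map_comp.
  rewrite !(eq_filter (a2 := predT)) ?filter_predT; try by move=> ?; rewrite inE.
  rewrite (eq_map (g := fun=> th0)) // [X in _ ++ X](eq_map (g := tnth (in_tuple v))) //.
  have map_cst (r : seq L) : [seq th0 | _ <- r] = nseq (size r) th0.
    by elim: r => //= ? ? ->.
  by rewrite enumJ map_cst -cardE cL.
have dlE (V : {set {set L}}) (e : {set L * L}) : V \subset N ->
    count_rel (rep_set J V) (rep_typ V th0 tau e) th = count_seq (dl (V, e) ++ v) th.
  move=> sVN; apply: count_rel_seq; rewrite enum_sum_set map_cat -!map_comp /dl /=.
  rewrite [X in _ ++ map _ X](eq_filter (a2 := predT)); last by move=> ?; rewrite inE /= eqxx.
  rewrite filter_predT [X in _ ++ X](eq_map (g := tnth (in_tuple v))) // enumJ.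
  rewrite (@eq_filter _ _ (fun i => node_rep V i == i)) //.
  by move=> i; rewrite inE /=.
pose X := [set E : {set (L + J) * (L + J)} |
  (E \subset offdiag setT) && (sum_typ setT E tau == th)].
have := @card_no_rigid_dvd p k L J G N X wr.
have actX E g : g \in G -> E \in X -> leaf_act E g \in X.
  move=> _; rewrite !inE => /andP[/subsetP sE /eqP eth]; apply/andP; split.
    apply/subsetP=> -[x y]; rewrite inE /= => /sE; rewrite !inE /=.
    by move=> h; apply: contraNneq h => ->.
  by rewrite (leaf_act_sum E g tauL) eth.
move/(_ actX); set X0 := [set E in X | _] => dvdX0.
suff eX0 : Posz #|X0| = (Posz (count_rel [set: L + J] tau th) -
    \sum_(i | (i.1 != set0) && (i.1 \subset N) && inner G i.1 i.2)
      - (-1) ^+ #|i.1| * Posz (count_seq (dl i ++ v) th))%R by rewrite -eX0.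
rewrite card_incl_excl.
(* The empty family contributes the full count; the nonempty ones give the sum over shorter
   words. *)
rewrite (bigD1 set0) //= cards0 expr0 mul1r.
have -> : [set x in X | [forall i in set0, (i \in N) && rigid_at G i x]] = X.
  by apply/setP=> E; rewrite [LHS]inE; case: (E \in X) => //=; apply/forall_inP=> A; rewrite inE.
congr (_ + _)%R; rewrite -sumrN.
rewrite -(pair_big_dep (fun V => (V != set0) && (V \subset N)) (fun V e => inner G V e)
  (fun V e => - (- (-1) ^+ #|V| * (count_seq (dl (V, e) ++ v) th)%:Z))%R) /=.
rewrite [RHS]big_mkcondr /=; apply: eq_bigr => V nV.
case: ifP => [sVN|nsVN].
  have := card_rigid_family th wr sVN tauL.
  rewrite (eq_bigr _ (fun e _ => dlE V e sVN)).
  move=> cE; transitivity ((-1) ^+ #|V| *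
      Posz (\sum_(e | inner G V e) count_seq (dl (V, e) ++ v) th))%R.
    by rewrite -cE; congr (_ * Posz _)%R; apply: eq_card => E; rewrite !inE.
  rewrite -natz natr_sum big_distrr /=; apply: eq_bigr => e _.
  by rewrite natz mulNr opprK.
(* A family with a member outside [N] contributes nothing, as membership in [N] is part of the
   excluded property. *)
rewrite (_ : [set _ in X | _] = set0) ?cards0 ?mulr0 //.
apply/setP=> E; rewrite !inE; apply/negP=> /andP[_ /forall_inP h].
by case/negP: nsVN; apply/subsetP=> A /h /andP[].
Qed.

End Reduce.

Lemma eqn_mod_dvdz (a b d : nat) :
  (a == b %[mod d]) = (Posz d %| Posz a - Posz b)%Z%R.
Proof. by rewrite -eqz_mod_dvd !modz_nat. Qed.

Lemma perm_count_nseq (T : eqType) (x : T) (w : seq T) n :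
  n <= count_mem x w ->
  exists2 w', perm_eq w (nseq n x ++ w') & size w = n + size w'.
Proof.
move=> le_n; pose w' := nseq (count_mem x w - n) x ++ filter (predC1 x) w.
have eq_w : perm_eq w (nseq n x ++ w').
  rewrite catA -nseqD subnKC // perm_sym; apply: perm_trans (permEl (perm_filterC (pred1 x) w)).
  by rewrite (all_pred1P _ _ (filter_all (pred1 x) w)) size_filter.
by exists w' => //; rewrite (perm_size eq_w) size_cat size_nseq.
Qed.

Lemma sum_count_mem (T : finType) (w : seq T) : \sum_x count_mem x w = size w.
Proof.
elim: w => [|y w IHw] /=; first by rewrite big1.
rewrite big_split /= IHw (bigD1 y) //= eqxx big1 // => x nxy.
by rewrite eq_sym (negPf nxy).
Qed.

(** Induction on the length of [w]: by pigeonhole a long word repeats some letter [p ^ k] times, and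
    [count_seq_reduce] expresses both sides through shorter words with the same coefficients. *)
Lemma count_seq_bounded M q s p k (u u' : seq (typ M q s)) : prime p ->
    (forall w th, size w < p ^ k * #|typ M q s| ->
       count_seq (w ++ u) th = count_seq (w ++ u') th %[mod p ^ k]) ->
  forall w th, count_seq (w ++ u) th = count_seq (w ++ u') th %[mod p ^ k].
Proof.
move=> p_pr small w; have [n] := ubnP (size w); elim: n w => // n IHn w.
rewrite ltnS => le_w th; have [lt_w|ge_w] := ltnP (size w) (p ^ k * #|typ M q s|).
  exact: small.
have N_gt0 : 0 < p ^ k by rewrite expn_gt0 prime_gt0.
have [th0 ge0] : exists th0, p ^ k <= count_mem th0 w.
  apply/existsP; apply: contraLR ge_w; rewrite negb_exists => /forallP h.
  rewrite -ltnNge -sum_count_mem -(prednK N_gt0) mulSn.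
  apply: (@leq_ltn_trans (\sum_(x : typ M q s) (p ^ k).-1)).
    by apply: leq_sum => x _; have := h x; rewrite -ltnNge -{1}(prednK N_gt0).
  rewrite sum_nat_const mulnC -[X in X < _]add0n ltn_add2r.
  by apply/card_gt0P; exists th.
have [w' eq_w sz_w] := perm_count_nseq ge0.
have [I [ok [c [dl [szdl red]]]]] := count_seq_reduce k th0 p_pr.
have pE t : count_seq (w ++ t) th = count_seq (nseq (p ^ k) th0 ++ (w' ++ t)) th.
  by apply: count_seq_perm; rewrite catA perm_cat2r.
apply/eqP; rewrite !pE eqn_mod_dvdz.
set a := Posz _; set b := Posz (count_seq _ _).
pose S t := (\sum_(i | ok i) c i * Posz (count_seq (dl i ++ w' ++ t) th))%R.
(* The first two differences vanish modulo [p ^ k] by the reduction, the last one by induction, term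
   by term. *)
rewrite (_ : a - b = (a - S u) - (b - S u') + (S u - S u'))%R; last first.
  by ring.
apply: rpredD; first by apply: rpredB; apply: red.
rewrite /S -sumrB rpred_sum // => i oki.
rewrite -mulrBr dvdz_mull // -eqn_mod_dvdz !catA; apply/eqP/IHn.
by apply: leq_trans le_w; rewrite size_cat sz_w ltn_add2r szdl.
Qed.

(** * Periodicity modulo every positive integer *)

Definition count_periodic M q s (pt : typ M q s) (m : nat) : Prop :=
  exists P Q, 0 < P /\ forall n w th, Q <= n ->
    count_seq (w ++ nseq (n + P) pt) th = count_seq (w ++ nseq n pt) th %[mod m].

(** The table [f n] of residues for all short prefixes takes finitely many values, so two lengths
    share a table; by [count_seq_bounded] they then agree for all prefixes. *)
Lemma count_periodic_pp M q s (pt : typ M q s) p k :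
  prime p -> count_periodic pt (p ^ k).
Proof.
move=> p_pr; set K := p ^ k * #|typ M q s|.
have N_gt0 : 0 < p ^ k by rewrite expn_gt0 prime_gt0.
pose F : finType := {ffun K.-bseq (typ M q s) * typ M q s -> 'I_(p ^ k)}.
pose f n : F :=
  [ffun x : K.-bseq (typ M q s) * typ M q s =>
     Ordinal (ltn_pmod (count_seq (x.1 ++ nseq n pt) x.2) N_gt0)].
have f_eq n n' : f n = f n' -> forall w th,
    count_seq (w ++ nseq n pt) th = count_seq (w ++ nseq n' pt) th %[mod p ^ k].
  move=> eqf; apply: count_seq_bounded => // w th lt_w.
  have szw : size w <= K by apply: ltnW.
  by have /ffunP/(_ (Bseq szw, th)) := eqf; rewrite !ffunE /= => -[].
have [n [n' [lt_nn' eqf]]] : exists n n', n < n' /\ f n = f n'.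
  have /injectivePn[x [y nxy eqf]] : ~~ injectiveb (fun i : 'I_#|F|.+1 => f i).
    by apply/injectiveP=> /leq_card; rewrite card_ord ltnn.
  case: (ltngtP x y) => [lt|lt|/val_inj e]; last by rewrite e eqxx in nxy.
    by exists x, y.
  by exists y, x.
(* For larger lengths the surplus [m - n] copies of [pt] are absorbed into the prefix. *)
exists (n' - n), n; split=> [|m w th le_nm]; first by rewrite subn_gt0.
have mE : m = (m - n) + n by rewrite subnK.
have mE' : m + (n' - n) = (m - n) + n' by rewrite {1}mE -addnA subnKC // ltnW.
by rewrite mE' {2}mE !nseqD !catA; apply/esym/f_eq.
Qed.

Lemma count_periodicM M q s (pt : typ M q s) a b :
  coprime a b -> count_periodic pt a -> count_periodic pt b ->
  count_periodic pt (a * b).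
Proof.
move=> cab [Pa [Qa [Pa0 ha]]] [Pb [Qb [Pb0 hb]]].
have mult m P Q : (forall n w th, Q <= n -> count_seq (w ++ nseq (n + P) pt) th =
      count_seq (w ++ nseq n pt) th %[mod m]) ->
    forall j n w th, Q <= n -> count_seq (w ++ nseq (n + j * P) pt) th =
      count_seq (w ++ nseq n pt) th %[mod m].
  move=> h; elim=> [|j IHj] n w th le_Q; first by rewrite addn0.
  by rewrite mulSn [P + _]addnC addnA h ?IHj // (leq_trans le_Q) ?leq_addr.
exists (Pa * Pb), (maxn Qa Qb); split; first by rewrite muln_gt0 Pa0.
move=> n w th; rewrite geq_max => /andP[leQa leQb].
apply/eqP; rewrite chinese_remainder //; apply/andP; split; apply/eqP.
  by rewrite mulnC (mult _ _ _ ha).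
by rewrite (mult _ _ _ hb).
Qed.

(** Induction on [m], splitting off the full power of its least prime divisor. *)
Theorem count_periodic_all M q s (pt : typ M q s) m : 0 < m -> count_periodic pt m.
Proof.
have [n] := ubnP m; elim: n m => // n IHn m; rewrite ltnS => le_mn m_gt0.
have [le_m1|lt1m] := leqP m 1.
  by exists 1, 0; split=> // *; move: le_m1 m_gt0; case: m {le_mn} => [|[]] // _ _; rewrite !modn1.
have p_pr := pdiv_prime lt1m; set p := pdiv m in p_pr.
rewrite -(partnC p m_gt0); apply: count_periodicM.
- exact: coprime_partC.
- by rewrite p_part; apply: count_periodic_pp.
apply: IHn; last exact: part_gt0.
apply: leq_trans le_mn; rewrite -[X in _ < X](partnC p m_gt0) ltn_Pmull ?part_gt0 //.
rewrite p_part; apply: (leq_trans (prime_gt1 p_pr)).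
rewrite -{1}(expn1 p) leq_exp2l ?prime_gt1 // logn_gt0 mem_primes p_pr m_gt0.
exact: pdiv_dvd.
Qed.

(** * Types determine truth *)

Definition upsets (T : finType) (E : {set T * T}) : {set {set T}} :=
  [set A : {set T} | [forall x in A, forall y, ((x, y) \in E) ==> (y \in A)]].

Lemma upsetsP (T : finType) (E : {set T * T}) (A : {set T}) :
  reflect (forall x y, x \in A -> (x, y) \in E -> y \in A) (A \in upsets E).
Proof.
rewrite inE; apply: (iffP forall_inP) => [h x y Ax Exy|h x Ax].
  by have /forallP/(_ y)/implyP := h x Ax; apply.
by apply/forallP=> y; apply/implyP; apply: h.
Qed.

(** For irreflexive [E] this says that the reflexive closure is a preorder; [x != z] is there
    because [E] carries no loops. *)
Definition transitive_off (T : finType) (E : {set T * T}) : bool :=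
  [forall x, forall y, forall z,
    [&& (x, y) \in E, (y, z) \in E & x != z] ==> ((x, z) \in E)].

Lemma transitive_offP (T : finType) (E : {set T * T}) :
  reflect (forall x y z, (x, y) \in E -> (y, z) \in E -> x != z -> (x, z) \in E)
          (transitive_off E).
Proof.
apply: (iffP forallP) => [h x y z Exy Eyz nxz|h x].
  by have /forallP/(_ y)/forallP/(_ z) := h x; rewrite Exy Eyz nxz.
apply/forallP=> y; apply/forallP=> z; apply/implyP=> /and3P[].
exact: h.
Qed.

Lemma env_cons0 (A : Type) k (a : A) (v : 'I_k -> A) : env_cons a v ord0 = a.
Proof. by rewrite /env_cons unlift_none. Qed.

Lemma env_consS (A : Type) k (a : A) (v : 'I_k -> A) i :
  env_cons a v (lift ord0 i) = v i.
Proof. by rewrite /env_cons liftK. Qed.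

Lemma eq_forall_back (A B : finType) (P : pred A) (Q : pred B) :
    (forall x, exists y, P x = Q y) -> (forall y, exists x, P x = Q y) ->
  [forall x, P x] = [forall y, Q y].
Proof.
move=> f b; apply/forallP/forallP => [h y|h x].
  by have [x <-] := b y.
by have [y ->] := f x.
Qed.

Lemma eq_exists_back (A B : finType) (P : pred A) (Q : pred B) :
    (forall x, exists y, P x = Q y) -> (forall y, exists x, P x = Q y) ->
  [exists x, P x] = [exists y, Q y].
Proof.
move=> f b; apply/existsP/existsP => [[x]|[y]].
  by have [y ->] := f x; exists y.
by have [x <-] := b y; exists x.
Qed.

Lemma eq_modnD d a b a' b' :
  a = a' %[mod d] -> b = b' %[mod d] -> a + b = a' + b' %[mod d].
Proof. by move=> ea eb; rewrite -(modnDm a b) ea eb modnDm. Qed.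

Lemma eq_modnM d a b a' b' :
  a = a' %[mod d] -> b = b' %[mod d] -> a * b = a' * b' %[mod d].
Proof. by move=> ea eb; rewrite -(modnMm a b) ea eb modnMm. Qed.

Lemma eq_modn_sum (I : finType) (P : pred I) d (f g : I -> nat) :
    (forall i, P i -> f i = g i %[mod d]) ->
  \sum_(i | P i) f i = \sum_(i | P i) g i %[mod d].
Proof.
by move=> efg; elim/big_rec2: _ => // i a b /efg ei eab; apply: eq_modnD.
Qed.

(** * Back-and-forth between structures of equal type *)

Section RankEquivalence.

Variable M : nat.

Definition rank_eq q w (T T' : finType) (E : {set T * T}) (E' : {set T' * T'})
    (W : 'I_w -> {set T}) (W' : 'I_w -> {set T'}) : Prop :=
  rank_typ M q E W = rank_typ M q E' W'.

Section Basic.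

Variables (w : nat) (T T' : finType) (E : {set T * T}) (E' : {set T' * T'}).
Variables (W : 'I_w -> {set T}) (W' : 'I_w -> {set T'}).

Lemma rank_eq_sym q : rank_eq q E E' W W' -> rank_eq q E' E W' W.
Proof. exact: esym. Qed.

Lemma rank_eq_le q q' : q <= q' -> rank_eq q' E E' W W' -> rank_eq q E E' W W'.
Proof.
elim: q' => [|q' IHq]; first by rewrite leqn0 => /eqP->.
rewrite leq_eqVlt => /orP[/eqP-> //|]; rewrite ltnS => le_q.
by rewrite /rank_eq !rank_typS => -[/IHq h _]; apply: h.
Qed.

Lemma rank_eq_back q (A : {set T}) : rank_eq q.+1 E E' W W' ->
  exists A' : {set T'}, rank_eq q E E' (env_cons A W) (env_cons A' W').
Proof.
rewrite /rank_eq !rank_typS => -[_ /setP/(_ (rank_typ M q E (env_cons A W)))].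
by rewrite imset_f // => /esym/imsetP[A' _ ?]; exists A'.
Qed.

Lemma rank0_inh l : atom_inh (rank_typ M 0 E W) l = (W l != set0).
Proof.
rewrite atomE; apply/exists_inP/set0Pn => [[i _]|[i Wi]].
  by rewrite atomE; exists i.
by exists i; rewrite ?inE ?atomE.
Qed.

Lemma rank0_cnt l : atom_cnt (rank_typ M 0 E W) l = inZp #|W l|.
Proof.
rewrite atomE; under eq_bigr do rewrite atomE.
have inZpD : {morph (@inZp M) : a b / a + b >-> (a + b)%R}.
  by move=> a b; apply: val_inj; rewrite /= modnDm.
rewrite -sum1_card (big_morph _ inZpD (_ : inZp 0 = 0%R)); last exact: val_inj.
rewrite [RHS]big_mkcond [LHS]big_mkcond; apply: eq_bigr => i _; rewrite inE.
by case: (i \in W l) => //; apply: val_inj.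
Qed.

Lemma rank0_sub l k : atom_sub (rank_typ M 0 E W) l k = (W l \subset W k).
Proof.
rewrite atomE; apply/forall_inP/subsetP => [h i Wi|h i _].
  by have := h i (in_setT i); rewrite atomE Wi.
by rewrite atomE; apply/implyP; apply: h.
Qed.

Lemma rank0_rel l k : atom_rel (rank_typ M 0 E W) l k =
  [exists i in W l, exists j in W k, (i != j) && ((i, j) \in E)].
Proof.
rewrite atomE; apply/orP/exists_inP.
  case=> [/exists_inP[i _]|/exists_inP[i _ /exists_inP[j _ /and4P[nij Eij]]]].
    by rewrite atomE.
  rewrite !atomE => Wi Wj; exists i => //; apply/exists_inP; exists j => //.
  by rewrite nij.
case=> i Wi /exists_inP[j Wj /andP[nij Eij]]; right.
apply/exists_inP; exists i; rewrite ?inE //.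
by apply/exists_inP; exists j; rewrite ?inE // !atomE nij Eij Wi Wj.
Qed.

End Basic.

Section Consequences.

Variables (w : nat) (T T' : finType) (E : {set T * T}) (E' : {set T' * T'}).
Variables (W : 'I_w -> {set T}) (W' : 'I_w -> {set T'}).

Lemma rank_eq_inh q l : rank_eq q E E' W W' -> (W l != set0) = (W' l != set0).
Proof. by move/(rank_eq_le (leq0n q)) => e; rewrite -(rank0_inh E) e rank0_inh. Qed.

Lemma rank_eq_card q l : rank_eq q E E' W W' -> #|W l| = #|W' l| %[mod M.+1].
Proof.
move/(rank_eq_le (leq0n q)) => e.
by have /(congr1 val) := rank0_cnt E W l; rewrite e rank0_cnt.
Qed.

Lemma rank_eq_sub q l k :
  rank_eq q E E' W W' -> (W l \subset W k) = (W' l \subset W' k).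
Proof. by move/(rank_eq_le (leq0n q)) => e; rewrite -(rank0_sub E) e rank0_sub. Qed.

Lemma rank_eq_mem q l k x x' : rank_eq q E E' W W' ->
  W l = [set x] -> W' l = [set x'] -> (x \in W k) = (x' \in W' k).
Proof. by move=> e Wx Wx'; have := rank_eq_sub l k e; rewrite Wx Wx' !sub1set. Qed.

Lemma rank_eq_edge q l k x x' y y' : rank_eq q E E' W W' ->
    W l = [set x] -> W' l = [set x'] -> W k = [set y] -> W' k = [set y'] ->
  (x != y) && ((x, y) \in E) = (x' != y') && ((x', y') \in E').
Proof.
move=> /(rank_eq_le (leq0n q)) e Wx Wx' Wy Wy'.
have one (U : finType) (F : {set U * U}) (X : 'I_w -> {set U}) a b :
    X l = [set a] -> X k = [set b] ->
    (a != b) && ((a, b) \in F) = atom_rel (rank_typ M 0 F X) l k.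
  move=> Xa Xb; rewrite rank0_rel Xa Xb; apply/idP/exists_inP => [h|].
    exists a; first exact: set11.
    by apply/exists_inP; exists b; first exact: set11.
  by case=> i /set1P-> /exists_inP[j /set1P->].
by rewrite (one _ _ W) // (one _ _ W') // e.
Qed.

End Consequences.

Section Single.

Variables (w : nat) (T T' : finType) (E : {set T * T}) (E' : {set T' * T'}).
Variables (W : 'I_w -> {set T}) (W' : 'I_w -> {set T'}).

(** Pick [y'] in [W' l] and match the set [[set y']] by some [A]. Then [A] is a nonempty subset of
    [[set y]], hence contains [W l], and this inclusion transfers back. *)
Lemma rank_eq_single q l y : rank_eq q.+1 E E' W W' -> W l = [set y] ->
  exists y', W' l = [set y'].
Proof.
move=> e Wy; have: W' l != set0.
  by rewrite -(rank_eq_inh l e) Wy; apply/set0Pn; exists y; rewrite set11.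
case/set0Pn=> y' Wy'; exists y'.
have [A eA] := rank_eq_back [set y'] (rank_eq_sym e).
have /(rank_eq_inh ord0) := eA; rewrite !env_cons0 => /esym.
have -> : [set y'] != set0 by apply/set0Pn; exists y'; rewrite set11.
case/set0Pn=> x Ax.
have := rank_eq_sub ord0 (lift ord0 l) eA.
rewrite !env_cons0 !env_consS sub1set Wy' Wy => /esym/subsetP/(_ x Ax)/set1P xy.
have := rank_eq_sub (lift ord0 l) ord0 eA.
rewrite !env_cons0 !env_consS Wy sub1set -xy Ax => s.
by apply/eqP; rewrite eqEsubset s sub1set.
Qed.

End Single.

Section Element.

Variables (w : nat) (T T' : finType) (E : {set T * T}) (E' : {set T' * T'}).
Variables (W : 'I_w -> {set T}) (W' : 'I_w -> {set T'}).

Lemma rank_eq_elem q y : rank_eq q.+2 E E' W W' ->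
  exists y', rank_eq q.+1 E E' (env_cons [set y] W) (env_cons [set y'] W').
Proof.
move/(rank_eq_back [set y]) => [A' e].
have [y' Ay'] := rank_eq_single (l := ord0) e (env_cons0 _ _).
by rewrite env_cons0 in Ay'; exists y'; rewrite -Ay'.
Qed.

End Element.

Section UpSet.

Variables (w : nat) (T T' : finType) (E : {set T * T}) (E' : {set T' * T'}).
Variables (W : 'I_w -> {set T}) (W' : 'I_w -> {set T'}).

Lemma rank_eq_upset_imp q l :
  rank_eq q.+2 E E' W W' -> W l \in upsets E -> W' l \in upsets E'.
Proof.
move=> e /upsetsP up; apply/upsetsP=> x' y' Wx' Exy'.
apply: contraTT (Exy') => nWy'.
have nxy' : x' != y' by apply: contraNneq nWy' => <-.
(* Only the end [y'] of the offending edge is matched: that an edge leads from set [l] to this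
   singleton is recorded in the atom. *)
have [y ey] := rank_eq_elem y' (rank_eq_sym e).
have nWy : y \notin W l.
  by have := rank_eq_mem (lift ord0 l) ey (env_cons0 _ _) (env_cons0 _ _);
     rewrite !env_consS (negPf nWy') => <-.
apply/negP=> Exy.
have /(rank_eq_le (leq0n _)) := ey.
move/(congr1 (fun t => atom_rel t (lift ord0 l) ord0)).
rewrite !rank0_rel !env_consS !env_cons0.
have -> : [exists i in W' l, exists j in [set y'], (i != j) && ((i, j) \in E')].
  apply/exists_inP; exists x' => //; apply/exists_inP; exists y'; rewrite ?set11 //.
  by rewrite nxy'.
case/esym/exists_inP=> x Wx /exists_inP[_ /set1P-> /andP[_ Exy0]].
by rewrite (up x) in nWy.
Qed.

End UpSet.

Section Definable.

Variables (w : nat) (T T' : finType) (E : {set T * T}) (E' : {set T' * T'}).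
Variables (W : 'I_w -> {set T}) (W' : 'I_w -> {set T'}).

Lemma rank_eq_upset q l :
  rank_eq q.+2 E E' W W' -> (W l \in upsets E) = (W' l \in upsets E').
Proof.
move=> e; apply/idP/idP; first exact: rank_eq_upset_imp e.
exact: rank_eq_upset_imp (rank_eq_sym e).
Qed.

(** Three rounds match [x'], [y'] and [z']; the fourth rank is the one that [rank_eq_elem] leaves
    unspent. *)
Lemma rank_eq_trans q : E \subset offdiag setT -> E' \subset offdiag setT ->
  rank_eq q.+4 E E' W W' -> transitive_off E -> transitive_off E'.
Proof.
move=> sE sE' e /transitive_offP tE; apply/transitive_offP=> x' y' z' Exy Eyz nxz.
have [x ex] := rank_eq_elem x' (rank_eq_sym e).
have [y ey] := rank_eq_elem y' ex.
have [z ez] := rank_eq_elem z' ey.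
have off (U : finType) (F : {set U * U}) a b : F \subset offdiag setT ->
    ((a, b) \in F) = (a != b) && ((a, b) \in F).
  move/subsetP/(_ (a, b)); rewrite inE /= !inE /=.
  by case: ((a, b) \in F) => [->|] //; rewrite andbF.
pose lx : 'I_w.+3 := lift ord0 (lift ord0 ord0).
pose ly : 'I_w.+3 := lift ord0 ord0.
pose lz : 'I_w.+3 := ord0.
have Wx (U : finType) (X : 'I_w -> {set U}) a b c :
    env_cons a (env_cons b (env_cons c X)) lx = c.
  by rewrite !env_consS env_cons0.
have Wy (U : finType) (X : 'I_w -> {set U}) a b c :
    env_cons a (env_cons b (env_cons c X)) ly = b.
  by rewrite !env_consS env_cons0.
have Wz (U : finType) (X : 'I_w -> {set U}) a b c :
    env_cons a (env_cons b (env_cons c X)) lz = a.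
  by rewrite env_cons0.
have exy := rank_eq_edge ez (Wx _ _ _ _ _) (Wx _ _ _ _ _) (Wy _ _ _ _ _) (Wy _ _ _ _ _).
have eyz := rank_eq_edge ez (Wy _ _ _ _ _) (Wy _ _ _ _ _) (Wz _ _ _ _ _) (Wz _ _ _ _ _).
have exz := rank_eq_edge ez (Wx _ _ _ _ _) (Wx _ _ _ _ _) (Wz _ _ _ _ _) (Wz _ _ _ _ _).
have emem := rank_eq_mem lz ez (Wx _ _ _ _ _) (Wx _ _ _ _ _).
rewrite !Wz !inE in emem.
rewrite off // exz -off //; apply: (tE x y z).
- by rewrite off // -exy -off.
- by rewrite off // -eyz -off.
by rewrite -emem.
Qed.

(** The set of points satisfying [P] is matched by some [A'] of the same cardinal modulo [M.+1];
    matching single points shows that [A'] is the set for [P']. The sets [A] and [A'] stay in the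
    context, so the hypothesis allows for them. *)
Lemma rank_eq_count q (P : pred T) (P' : pred T') :
    rank_eq q.+3 E E' W W' ->
    (forall A A' y y', rank_eq q.+1 E E'
       (env_cons [set y] (env_cons A W)) (env_cons [set y'] (env_cons A' W')) ->
       P y = P' y') ->
  #|[set y | P y]| = #|[set y | P' y]| %[mod M.+1].
Proof.
move=> e eP; have [A' eA] := rank_eq_back [set y | P y] e.
suff <- : A' = [set y | P' y].
  by have := rank_eq_card ord0 eA; rewrite !env_cons0.
apply/setP=> y'; have [y ey] := rank_eq_elem y' (rank_eq_sym eA).
have := rank_eq_mem (lift ord0 ord0) ey (env_cons0 _ _) (env_cons0 _ _).
by rewrite !env_consS !env_cons0 !inE => ->; apply: eP (rank_eq_sym ey).
Qed.

(** The sum is sorted by the residues of its terms, and each residue class is counted by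
    [rank_eq_count]. *)
Lemma rank_eq_sum q (f : T -> nat) (f' : T' -> nat) :
    rank_eq q.+3 E E' W W' ->
    (forall A A' y y', rank_eq q.+1 E E'
       (env_cons [set y] (env_cons A W)) (env_cons [set y'] (env_cons A' W')) ->
       f y = f' y' %[mod M.+1]) ->
  \sum_y f y = \sum_y f' y %[mod M.+1].
Proof.
move=> e ef.
have sumE (U : finType) (g : U -> nat) : \sum_y g y =
    \sum_(a < M.+1) a * #|[set y | g y %% M.+1 == a]| %[mod M.+1].
  transitivity ((\sum_y g y %% M.+1) %% M.+1); last first.
    congr (_ %% _).
    rewrite (partition_big (fun y => inord (g y %% M.+1) : 'I_M.+1) predT) //=.
    apply: eq_bigr => a _; rewrite mulnC -sum_nat_const.
    apply: eq_big => [y|y]; rewrite ?inE -val_eqE /= inordK ?ltn_pmod //.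
    by move/eqP.
  by apply: eq_modn_sum => y _; rewrite modn_mod.
rewrite (sumE T f) (sumE T' f'); apply: eq_modn_sum => a _; apply: eq_modnM => //.
apply: (rank_eq_count e) => B B' z z' h /=.
by rewrite (ef B B' z z' h).
Qed.

End Definable.

End RankEquivalence.

(** Three ranks per quantifier cover every case: an open-set quantifier spends one and needs two
    left to recognise up-sets, a counting quantifier matches a set and then a point. *)
Fixpoint depth r e s o (phi : formula r e s o) : nat :=
  match phi with
  | EqX _ _ | EqS _ _ | EqO _ _ | InO _ _ | InS _ _ => 0
  | Not f => depth f
  | And f g | Or f g => maxn (depth f) (depth g)
  | AllX f | ExX f | AllS f | ExS f | AllO f | ExO f | Count _ _ _ f => (depth f).+3
  end.

(** A common multiple of the counting moduli, so that cardinals modulo a single number decide every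
    [Count]. *)
Fixpoint modulus r e s o (phi : formula r e s o) : nat :=
  match phi with
  | EqX _ _ | EqS _ _ | EqO _ _ | InO _ _ | InS _ _ => 1
  | Not f => modulus f
  | And f g | Or f g => modulus f * modulus g
  | AllX f | ExX f | AllS f | ExS f | AllO f | ExO f => modulus f
  | Count m _ _ f => m * modulus f
  end.

Lemma modulus_gt0 r e s o (phi : formula r e s o) : 0 < modulus phi.
Proof.
elim: phi => //= {e s o} e s o.
- by move=> f Hf g Hg; rewrite muln_gt0 Hf.
- by move=> f Hf g Hg; rewrite muln_gt0 Hf.
by move=> m a m_gt0 f Hf; rewrite muln_gt0 m_gt0.
Qed.

(* [W] lists the values of all variables as sets, elements as singletons; the
   index maps say where each variable of the formula sits in that list. *)
Definition interp (T : finType) r e s o w (W : 'I_w -> {set T})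
    (jC : 'I_r -> 'I_w) (jX : 'I_e -> 'I_w) (jS : 'I_s -> 'I_w) (jO : 'I_o -> 'I_w)
    (c : 'I_r -> T) (x : 'I_e -> T) (S : 'I_s -> {set T}) (V : 'I_o -> {set T}) : Prop :=
  [/\ forall i, W (jC i) = [set c i], forall i, W (jX i) = [set x i],
      forall i, W (jS i) = S i & forall i, W (jO i) = V i].

Definition shift w k (f : 'I_k -> 'I_w) (i : 'I_k) : 'I_w.+1 := lift ord0 (f i).

Definition shift_cons w k (f : 'I_k -> 'I_w) : 'I_k.+1 -> 'I_w.+1 :=
  env_cons ord0 (shift f).

Lemma env_shift_cons (A B : Type) (h : B -> A) w k (W : 'I_w -> A) (a : A)
    (f : 'I_k -> 'I_w) (b : B) (v : 'I_k -> B) :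
    a = h b -> (forall i, W (f i) = h (v i)) ->
  forall i, env_cons a W (shift_cons f i) = h (env_cons b v i).
Proof.
move=> -> hW i; rewrite /shift_cons.
by case: (unliftP ord0 i) => [j ->|->]; rewrite ?env_cons0 // !env_consS.
Qed.

Section Interp.

Variables (T : finType) (r e s o w : nat) (W : 'I_w -> {set T}).
Variables (jC : 'I_r -> 'I_w) (jX : 'I_e -> 'I_w) (jS : 'I_s -> 'I_w) (jO : 'I_o -> 'I_w).
Variables (c : 'I_r -> T) (x : 'I_e -> T) (S : 'I_s -> {set T}) (V : 'I_o -> {set T}).
Hypothesis iW : interp W jC jX jS jO c x S V.

Lemma interp_shift A :
  interp (env_cons A W) (shift jC) (shift jX) (shift jS) (shift jO) c x S V.
Proof. by case: iW => h1 h2 h3 h4; split=> i; rewrite env_consS. Qed.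

Lemma interpX y : interp (env_cons [set y] W) (shift jC) (shift_cons jX) (shift jS)
  (shift jO) c (env_cons y x) S V.
Proof.
case: iW => h1 h2 h3 h4; split=> i; rewrite ?env_consS //.
exact: (env_shift_cons (h := fun z => [set z])).
Qed.

Lemma interpS A : interp (env_cons A W) (shift jC) (shift jX) (shift_cons jS)
  (shift jO) c x (env_cons A S) V.
Proof.
case: iW => h1 h2 h3 h4; split=> i; rewrite ?env_consS //.
exact: (env_shift_cons (h := id)).
Qed.

Lemma interpO A : interp (env_cons A W) (shift jC) (shift jX) (shift jS)
  (shift_cons jO) c x S (env_cons A V).
Proof.
case: iW => h1 h2 h3 h4; split=> i; rewrite ?env_consS //.
exact: (env_shift_cons (h := id)).
Qed.

Lemma interp_term t : W (match t with Var i => jX i | Cst i => jC i end) =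
  [set teval c x t].
Proof. by case: iW => h1 h2 h3 h4; case: t => i /=. Qed.

End Interp.

Section HoldsRank.

Variable M : nat.

Definition rank_determined r e s o (phi : formula r e s o) : Prop :=
  forall (T T' : finType) (E : {set T * T}) (E' : {set T' * T'}) q w
    (W : 'I_w -> {set T}) (W' : 'I_w -> {set T'}) jC jX jS jO c x S V c' x' S' V',
    depth phi <= q -> modulus phi %| M.+1 -> rank_eq M q E E' W W' ->
    interp W jC jX jS jO c x S V -> interp W' jC jX jS jO c' x' S' V' ->
  holds (upsets E) c x S V phi = holds (upsets E') c' x' S' V' phi.

Lemma rank_determinedP r e s o (phi : formula r e s o) (T T' : finType)
    (E : {set T * T}) (E' : {set T' * T'}) q w
    (W : 'I_w -> {set T}) (W' : 'I_w -> {set T'}) jC jX jS jO c x S V c' x' S' V' :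
    rank_determined phi ->
    depth phi <= q -> modulus phi %| M.+1 -> rank_eq M q E E' W W' ->
    interp W jC jX jS jO c x S V -> interp W' jC jX jS jO c' x' S' V' ->
  holds (upsets E) c x S V phi = holds (upsets E') c' x' S' V' phi.
Proof. by move=> h; apply: h. Qed.

(** Induction on [phi]: atomic formulas are inclusions between listed sets, and at a quantifier the
    back-and-forth lemmas supply the matching value, which is added to both lists. *)
Lemma holds_rank r e s o (phi : formula r e s o) : rank_determined phi.
Proof.
elim: phi =>
  {e s o} e s o => [t u|i j|i j|t i|t i|f IHf|f IHf g IHg|f IHf g IHg
    |f IHf|f IHf|f IHf|f IHf|f IHf|f IHf|m a m_gt0 f IHf]
  T T' E E' q w W W' jC jX jS jO c x S V c' x' S' V' /= dq dm eqW iW iW'.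
- have := rank_eq_mem _ eqW (interp_term iW t) (interp_term iW' t).
  move/(_ (match u with Var i => jX i | Cst i => jC i end)).
  by rewrite (interp_term iW) (interp_term iW') !inE.
- case: iW iW' => _ _ iS _ [_ _ iS' _].
  by rewrite !eqEsubset -!iS -!iS' !(rank_eq_sub _ _ eqW).
- case: iW iW' => _ _ _ iO [_ _ _ iO'].
  by rewrite !eqEsubset -!iO -!iO' !(rank_eq_sub _ _ eqW).
- have := rank_eq_mem (jO i) eqW (interp_term iW t) (interp_term iW' t).
  by case: iW iW' => _ _ _ -> [_ _ _ ->].
- have := rank_eq_mem (jS i) eqW (interp_term iW t) (interp_term iW' t).
  by case: iW iW' => _ _ -> _ [_ _ -> _].
- by rewrite (rank_determinedP IHf dq dm eqW iW iW').
- move: dq; rewrite geq_max => /andP[dqf dqg].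
  rewrite (rank_determinedP IHf dqf (dvdn_trans (dvdn_mulr _ (dvdnn _)) dm) eqW iW iW').
  by rewrite (rank_determinedP IHg dqg (dvdn_trans (dvdn_mull _ (dvdnn _)) dm) eqW iW iW').
- move: dq; rewrite geq_max => /andP[dqf dqg].
  rewrite (rank_determinedP IHf dqf (dvdn_trans (dvdn_mulr _ (dvdnn _)) dm) eqW iW iW').
  by rewrite (rank_determinedP IHg dqg (dvdn_trans (dvdn_mull _ (dvdnn _)) dm) eqW iW iW').
all: case: q dq eqW => [|[|[|q]]] //; rewrite !ltnS => dq eqW.
all: have dq2 : depth f <= q.+2 by rewrite (leq_trans dq) // -addn2 leq_addr.
1,2: have forX y y' : rank_eq M q.+2 E E' (env_cons [set y] W) (env_cons [set y'] W') ->
       holds (upsets E) c (env_cons y x) S V f =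
       holds (upsets E') c' (env_cons y' x') S' V' f
  by move=> ey; apply: (rank_determinedP IHf dq2 dm ey (interpX iW y) (interpX iW' y')).
3,4: have forS A A' : rank_eq M q.+2 E E' (env_cons A W) (env_cons A' W') ->
       holds (upsets E) c x (env_cons A S) V f =
       holds (upsets E') c' x' (env_cons A' S') V' f
  by move=> eA; apply: (rank_determinedP IHf dq2 dm eA (interpS iW A) (interpS iW' A')).
5,6: have forO A A' : rank_eq M q.+2 E E' (env_cons A W) (env_cons A' W') ->
       (A \in upsets E, holds (upsets E) c x S (env_cons A V) f) =
       (A' \in upsets E', holds (upsets E') c' x' S' (env_cons A' V') f)
  by move=> eA; have := rank_eq_upset ord0 eA; rewrite !env_cons0 => ->;
     rewrite (rank_determinedP IHf dq2 dm eA (interpO iW A) (interpO iW' A')).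
- apply: eq_forall_back => [y|y'].
    by have [y' /forX] := rank_eq_elem y eqW; exists y'.
  by have [y /rank_eq_sym/forX] := rank_eq_elem y' (rank_eq_sym eqW); exists y.
- apply: eq_exists_back => [y|y'].
    by have [y' /forX] := rank_eq_elem y eqW; exists y'.
  by have [y /rank_eq_sym/forX] := rank_eq_elem y' (rank_eq_sym eqW); exists y.
- apply: eq_forall_back => [A|A'].
    by have [A' /forS] := rank_eq_back A eqW; exists A'.
  by have [A /rank_eq_sym/forS] := rank_eq_back A' (rank_eq_sym eqW); exists A.
- apply: eq_exists_back => [A|A'].
    by have [A' /forS] := rank_eq_back A eqW; exists A'.
  by have [A /rank_eq_sym/forS] := rank_eq_back A' (rank_eq_sym eqW); exists A.
- apply: eq_forall_back => [A|A'].
    by have [A' /forO[-> ->]] := rank_eq_back A eqW; exists A'.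
  by have [A /rank_eq_sym/forO[<- <-]] := rank_eq_back A' (rank_eq_sym eqW); exists A.
- apply: eq_exists_back => [A|A'].
    by have [A' /forO[-> ->]] := rank_eq_back A eqW; exists A'.
  by have [A /rank_eq_sym/forO[<- <-]] := rank_eq_back A' (rank_eq_sym eqW); exists A.
have dvd_m : m %| M.+1 := dvdn_trans (dvdn_mulr _ (dvdnn _)) dm.
have dvd_f : modulus f %| M.+1 := dvdn_trans (dvdn_mull _ (dvdnn _)) dm.
rewrite -(modn_dvdm _ dvd_m) -[X in _ = (X == _)](modn_dvdm _ dvd_m).
congr (_ %% _ == _); apply: (rank_eq_count eqW) => A A' y y' ey.
by apply: (rank_determinedP IHf _ dvd_f ey (interpX (interp_shift iW A) y)
  (interpX (interp_shift iW' A') y')); apply: leq_trans dq _.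
Qed.

End HoldsRank.

(** * Topologies and relations *)

Lemma upsets_topology (T : finType) (E : {set T * T}) : is_topology (upsets E).
Proof.
apply/and4P; split.
- by apply/upsetsP=> x y; rewrite inE.
- by apply/upsetsP=> x y; rewrite !inE.
- apply/forall_inP=> A /upsetsP uA; apply/forall_inP=> B /upsetsP uB.
  apply/upsetsP=> x y /setIP[Ax Bx] Exy.
  by apply/setIP; split; [apply: uA Ax Exy | apply: uB Bx Exy].
apply/forallP=> F; apply/implyP=> /subsetP sF; apply/upsetsP=> x y.
case/bigcupP=> A FA Ax Exy; apply/bigcupP; exists A => //.
by have /upsetsP uA := sF A FA; apply: uA Exy.
Qed.

Lemma upsets_inj (T : finType) :
  {in [set E : {set T * T} | (E \subset offdiag setT) && transitive_off E] &,
     injective (@upsets T)}.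
Proof.
have sub (E E' : {set T * T}) : E \subset offdiag setT -> transitive_off E' ->
    upsets E = upsets E' -> E \subset E'.
  move=> /subsetP sE /transitive_offP tE' eu; apply/subsetP=> -[x y] Exy.
  have := sE _ Exy; rewrite inE /= => /and3P[_ _ nxy].
  (* The point [x] with its successors is an up-set for [E'], hence for [E], and so contains [y]. *)
  have: [set z | (z == x) || ((x, z) \in E')] \in upsets E'.
    apply/upsetsP=> a b; rewrite !inE => /orP[/eqP->|Exa] Eab.
      by rewrite Eab orbT.
    by have [//|nbx] := eqVneq b x; rewrite (tE' x a b) // eq_sym.
  rewrite -eu => /upsetsP/(_ x y); rewrite !inE eqxx => /(_ isT Exy).
  by rewrite eq_sym (negPf nxy).
move=> E E'; rewrite !inE => /andP[sE tE] /andP[sE' tE'] eu.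
by apply/eqP; rewrite eqEsubset; apply/andP; split; apply: sub.
Qed.

(** The relation is the specialisation order: [x] is below [y] when every open set containing [x]
    contains [y]. *)
Lemma topology_upsets (T : finType) :
  [set O : {set {set T}} | is_topology O] =
  @upsets T @: [set E : {set T * T} | (E \subset offdiag setT) && transitive_off E].
Proof.
apply/setP=> O; rewrite inE; apply/idP/imsetP => [/and4P[O0 OT OI OU]|[E _ ->]]; last first.
  exact: upsets_topology.
pose E := [set z : T * T | (z.1 != z.2) &&
  [forall A in O, (z.1 \in A) ==> (z.2 \in A)]].
have EP x y A : (x, y) \in E -> A \in O -> x \in A -> y \in A.
  by rewrite inE => /andP[_ /forall_inP h] /h /implyP.
exists E.
  rewrite inE; apply/andP; split.
    by apply/subsetP=> -[x y]; rewrite !inE /= => /andP[].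
  apply/transitive_offP=> x y z Exy Eyz nxz; rewrite inE /= nxz.
  apply/forall_inP=> A OA; apply/implyP=> Ax.
  exact: EP Eyz OA (EP _ _ _ Exy OA Ax).
apply/setP=> A; apply/idP/upsetsP => [OA x y Ax Exy|uA].
  exact: EP Exy OA Ax.
(* The least open neighbourhood of [x], open by finiteness; an up-set is the union of those of its
   points. *)
pose U x := \bigcap_(B in O | x \in B) B.
have OUx x : U x \in O.
  rewrite /U; elim/big_rec: _ => // B C /andP[OB _] OC.
  by have /forall_inP/(_ B OB)/forall_inP/(_ C OC) := OI.
have -> : A = cover [set U x | x in A].
  rewrite cover_imset; apply/setP=> y; apply/idP/bigcupP => [Ay|[x Ax /bigcapP Uy]].
    by exists y => //; apply/bigcapP=> B /andP[].
  have [-> //|nyx] := eqVneq y x; apply: uA Ax _; rewrite inE /= eq_sym nyx.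
  apply/forall_inP=> B OB; apply/implyP=> Bx.
  by apply: Uy; rewrite OB.
have /forallP/(_ [set U x | x in A])/implyP := OU; apply.
by apply/subsetP=> _ /imsetP[x _ ->].
Qed.

Lemma sum_topology (T : finType) (h : {set {set T}} -> nat) :
  \sum_(O | is_topology O) h O =
  \sum_(E : {set T * T} | E \subset offdiag setT) transitive_off E * h (upsets E).
Proof.
under eq_bigl do rewrite -in_set; rewrite topology_upsets big_imset /=; last first.
  exact: upsets_inj.
rewrite [RHS](bigID (fun E => transitive_off E)) /= [X in _ = _ + X]big1 ?addn0.
  apply: eq_big => [E|E]; rewrite inE // => /andP[_ ->].
  by rewrite mul1n.
by move=> E /andP[_ /negPf->].
Qed.

Lemma sum_ffun_cons (T : finType) r (F : {ffun 'I_r.+1 -> T} -> nat) :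
  \sum_c F c = \sum_(c : {ffun 'I_r -> T}) \sum_y F (finfun (env_cons y c)).
Proof.
pose h (p : {ffun 'I_r -> T} * T) : {ffun 'I_r.+1 -> T} := finfun (env_cons p.2 p.1).
pose h' (c : {ffun 'I_r.+1 -> T}) : {ffun 'I_r -> T} * T :=
  ([ffun i => c (lift ord0 i)], c ord0).
rewrite pair_big /= (reindex h) //; apply: onW_bij; exists h' => [[c y]|c].
  congr (_, _); last by rewrite ffunE env_cons0.
  by apply/ffunP=> i; rewrite !ffunE env_consS.
apply/ffunP=> i; rewrite ffunE /=.
by case: (unliftP ord0 i) => [j ->|->]; rewrite ?env_cons0 // env_consS ffunE.
Qed.

(** The constants are summed out one at a time by [rank_eq_sum], with a budget of three ranks for
    each. *)
Lemma rank_sum_ffun M r (f : forall T : finType, {set T * T} -> ('I_r -> T) -> nat) q :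
    (forall (T T' : finType) (E : {set T * T}) (E' : {set T' * T'}) w
       (W : 'I_w -> {set T}) (W' : 'I_w -> {set T'}) (j : 'I_r -> 'I_w) c c',
       rank_eq M q.+1 E E' W W' -> (forall i, W (j i) = [set c i]) ->
       (forall i, W' (j i) = [set c' i]) -> f T E c = f T' E' c' %[mod M.+1]) ->
  forall (T T' : finType) (E : {set T * T}) (E' : {set T' * T'}) w
    (W : 'I_w -> {set T}) (W' : 'I_w -> {set T'}),
    rank_eq M (q + 3 * r).+1 E E' W W' ->
  \sum_(c : {ffun 'I_r -> T}) f T E c = \sum_(c : {ffun 'I_r -> T'}) f T' E' c %[mod M.+1].
Proof.
elim: r f q => [|r IHr] f q hf T T' E E' w W W' eqW.
  have one (U : finType) (g : {ffun 'I_0 -> U} -> nat) c0 : \sum_c g c = g c0.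
    rewrite (bigD1 c0) //= big1 ?addn0 // => c /eqP[].
    by apply/ffunP=> -[].
  rewrite (one T _ (finfun (@env_nil T))) (one T' _ (finfun (@env_nil T'))).
  by apply: (hf _ _ _ _ w W W' (@env_nil _)) => [|[]|[]] //; rewrite addn0 in eqW.
pose f' (U : finType) (F : {set U * U}) c := \sum_y f U F (env_cons y c).
(* The hypothesis on [f], applied to a structure and itself, gives invariance under pointwise
   equality of the constants; this replaces [finfun] by [env_cons]. *)
have ext (U : finType) (F : {set U * U}) :
    \sum_(c : {ffun 'I_r.+1 -> U}) f U F c = \sum_(c : {ffun 'I_r -> U}) f' U F c %[mod M.+1].
  rewrite sum_ffun_cons; apply: eq_modn_sum => c _; apply: eq_modn_sum => y _.
  apply: (hf _ _ _ _ r.+1 (fun i => [set env_cons y c i]) (fun i => [set env_cons y c i]) id) => //.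
  by move=> i; rewrite ffunE.
rewrite (ext T E) (ext T' E'); apply: (IHr f' (q + 3)); last first.
  by rewrite -addnA -mulnS; apply: eqW.
move=> {}T {}T' {}E {}E' {}w {}W {}W' j c c' {}eqW Wc Wc'.
apply: (@rank_eq_sum M w T T' E E' W W' q).
  by apply: rank_eq_le eqW; rewrite addnC.
move=> A A' y y' ey; apply: (hf _ _ _ _ _ _ _ (shift_cons (shift j)) _ _ ey).
  by apply: (env_shift_cons (h := fun z => [set z])) => // i; rewrite env_consS.
by apply: (env_shift_cons (h := fun z => [set z])) => // i; rewrite env_consS.
Qed.

(** The values of hard-wired constants as singletons, so that types can refer to them. *)
Definition marks s n (l : 'I_s) : {set 'I_n} := [set i : 'I_n | (i : nat) == l].

(** Each marked point has a letter of its own, and the remaining [n - s] points share one letter;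
    growing [n] appends copies of that letter. *)
Lemma marks_rank M q s n th : s <= n ->
  #|[set E : {set 'I_n * 'I_n} |
      (E \subset offdiag setT) && (rank_typ M q E (@marks s n) == th)]| =
  count_seq ([seq point_typ M q (fun l : 'I_s => i == l :> nat) | i <- iota 0 s] ++
             nseq (n - s) (point_typ M q (fun _ : 'I_s => false))) th.
Proof.
move=> le_sn; rewrite -(count_rel_seq (D := [set: 'I_n])
  (tau := fun i => point_typ M q (fun l => i \in @marks s n l))) //.
rewrite enum_setT -enumT; pose h i := point_typ M q (fun l : 'I_s => i == l :> nat).
rewrite (eq_map (g := h \o val)); last first.
  by move=> i; apply: point_typ_ext => l; rewrite inE.
rewrite map_comp val_enum_ord -[in iota 0 n](subnKC le_sn) iotaD map_cat perm_cat2l add0n.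
suff -> : [seq h i | i <- iota s (n - s)] = nseq (n - s) (point_typ M q (fun=> false)) by [].
rewrite -{2}(size_iota s (n - s)); have : {subset iota s (n - s) <= leq s}.
  by move=> i; rewrite mem_iota => /andP[].
elim: (iota s (n - s)) => //= i t IHt sub.
rewrite IHt; last by move=> j tj; apply: sub; rewrite inE tj orbT.
congr (_ :: _); apply: point_typ_ext => l; apply/negP=> /eqP il.
have /sub : i \in i :: t by rewrite inE eqxx.
by rewrite -topredE /= il leqNgt ltn_ord.
Qed.

(** Modulo [m] the weight depends only on the type, and the number of relations of each type is
    periodic. *)
Lemma weighted_sum_periodic M q s m
    (g : forall n, {set 'I_n * 'I_n} -> nat) : 0 < m ->
    (forall n n' (E : {set 'I_n * 'I_n}) (E' : {set 'I_n' * 'I_n'}),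
       s <= n -> s <= n' -> E \subset offdiag setT -> E' \subset offdiag setT ->
       rank_eq M q E E' (@marks s n) (@marks s n') -> g n E = g n' E' %[mod m]) ->
  exists p b : nat, 0 < p /\ forall n, b <= n ->
    \sum_(E : {set 'I_(n + p) * 'I_(n + p)} | E \subset offdiag setT) g (n + p) E =
    \sum_(E : {set 'I_n * 'I_n} | E \subset offdiag setT) g n E %[mod m].
Proof.
move=> m_gt0 compat.
have [p [b [p_gt0 per]]] :=
  count_periodic_all (point_typ M q (fun _ : 'I_s => false)) m_gt0.
exists p, (b + s); split=> // n le_n.
have le_sn : s <= n by apply: leq_trans le_n; rewrite leq_addl.
have le_snp : s <= n + p by rewrite (leq_trans le_sn) ?leq_addr.
pose C k th := [set E : {set 'I_k * 'I_k} |
      (E \subset offdiag setT) && (rank_typ M q E (@marks s k) == th)].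
have cE th : #|C (n + p) th| = #|C n th| %[mod m].
  rewrite !marks_rank // -addnC -addnBA // addnC; apply: per.
  by rewrite leq_subRL // addnC.
(* The weight is read from a representative on either carrier; the default 0 is taken only for types
   realised on neither. *)
pose wt th := if [pick E in C n th] is Some E then g n E
              else if [pick E in C (n + p) th] is Some E then g (n + p) E else 0.
have sumE k : (forall th E, E \in C k th -> g k E = wt th %[mod m]) ->
    \sum_(E : {set 'I_k * 'I_k} | E \subset offdiag setT) g k E =
    \sum_th #|C k th| * wt th %[mod m].
  move=> gwt.
  rewrite (partition_big (fun E => rank_typ M q E (@marks s k)) predT) //=.
  apply: eq_modn_sum => th _; rewrite -sum_nat_const.
  transitivity ((\sum_(E in C k th) g k E) %% m).
    by congr (_ %% _); apply: eq_bigl => E; rewrite inE.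
  by apply: eq_modn_sum => E; apply: gwt.
have sumn : forall th E, E \in C n th -> g n E = wt th %[mod m].
  move=> th E CE; rewrite /wt; case: pickP => [E' CE'|/(_ E)]; last by rewrite CE.
  move: CE CE'; rewrite !inE => /andP[sE /eqP eE] /andP[sE' /eqP eE'].
  by apply: compat => //; rewrite /rank_eq eE eE'.
have sumnp : forall th E, E \in C (n + p) th -> g (n + p) E = wt th %[mod m].
  move=> th E CE; rewrite /wt; case: pickP => [E' CE'|_].
    move: CE CE'; rewrite !inE => /andP[sE /eqP eE] /andP[sE' /eqP eE'].
    by apply: compat => //; rewrite /rank_eq eE eE'.
  case: pickP => [E' CE'|/(_ E)]; last by rewrite CE.
  move: CE CE'; rewrite !inE => /andP[sE /eqP eE] /andP[sE' /eqP eE'].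
  by apply: compat => //; rewrite /rank_eq eE eE'.
rewrite (sumE (n + p) sumnp) (sumE n sumn); apply: eq_modn_sum => th _.
exact: eq_modnM.
Qed.

(** * The two counting functions *)

Import Order.TTheory Num.Theory.

Lemma hardwired_models (r n : nat) (sigma : sentence r) (O : {set {set 'I_n}})
    (le_rn : r <= n) :
  [exists c : {ffun 'I_r -> 'I_n}, hardwired c && models O c sigma] =
  models O (finfun (widen_ord le_rn)) sigma.
Proof.
apply/existsP/idP => [[c /andP[/forallP hc]]|h].
  suff -> : c = finfun (widen_ord le_rn) by [].
  by apply/ffunP=> i; rewrite ffunE; apply/val_inj/eqP; rewrite hc.
exists (finfun (widen_ord le_rn)); rewrite h andbT.
by apply/forallP=> i; rewrite ffunE.
Qed.

Lemma count_hardwiredE (r n : nat) (sigma : sentence r) :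
  count_hardwired sigma n =
  \sum_(E : {set 'I_n * 'I_n} | E \subset offdiag setT) transitive_off E *
    [exists c : {ffun 'I_r -> 'I_n}, hardwired c && models (upsets E) c sigma].
Proof.
rewrite -(sum_topology (fun O : {set {set 'I_n}} =>
  [exists c : {ffun 'I_r -> 'I_n}, hardwired c && models O c sigma] : nat)).
rewrite /count_hardwired -sum1_card big_mkcond [RHS]big_mkcond.
by apply: eq_bigr => O _; rewrite inE; case: is_topology => //=; case: existsP.
Qed.

Lemma count_freeE (r n : nat) (sigma : sentence r) :
  count_free sigma n =
  \sum_(E : {set 'I_n * 'I_n} | E \subset offdiag setT) transitive_off E *
    \sum_(c : {ffun 'I_r -> 'I_n}) models (upsets E) c sigma.
Proof.
rewrite -(sum_topology (fun O : {set {set 'I_n}} =>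
  \sum_(c : {ffun 'I_r -> 'I_n}) (models O c sigma : nat))).
transitivity (\sum_(p : {set {set 'I_n}} * {ffun 'I_r -> 'I_n})
    (is_topology p.1 && models p.1 p.2 sigma : nat)).
  rewrite /count_free -sum1_card big_mkcond /=; apply: eq_bigr => p _.
  by rewrite inE; case: (_ && _).
rewrite -(pair_bigA _ (fun (O : {set {set 'I_n}}) (c : {ffun 'I_r -> 'I_n}) =>
  (is_topology O && models O c sigma : nat))) /= [RHS]big_mkcond.
apply: eq_bigr => O _; case: ifP => topO; first exact: eq_bigr.
by rewrite big1.
Qed.

Lemma models_rank M q r (sigma : sentence r) (T T' : finType)
    (E : {set T * T}) (E' : {set T' * T'}) w
    (W : 'I_w -> {set T}) (W' : 'I_w -> {set T'}) (j : 'I_r -> 'I_w) c c' :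
    depth sigma <= q -> modulus sigma %| M.+1 -> rank_eq M q E E' W W' ->
    (forall i, W (j i) = [set c i]) -> (forall i, W' (j i) = [set c' i]) ->
  models (upsets E) c sigma = models (upsets E') c' sigma.
Proof.
move=> dq dm eqW Wc Wc'; have nil k : 'I_0 -> 'I_k by case.
apply: (@rank_determinedP M _ _ _ _ sigma _ _ E E' q w W W' j (nil w) (nil w) (nil w)) => //.
- exact: holds_rank.
- by split=> // -[].
by split=> // -[].
Qed.

Lemma transitive_off_rank M q (T T' : finType)
    (E : {set T * T}) (E' : {set T' * T'}) w
    (W : 'I_w -> {set T}) (W' : 'I_w -> {set T'}) :
    E \subset offdiag setT -> E' \subset offdiag setT ->
    3 < q -> rank_eq M q E E' W W' ->
  transitive_off E = transitive_off E'.
Proof.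
move=> sE sE' q4 eqW; apply/idP/idP.
  exact: (rank_eq_trans (q := 0) sE sE' (rank_eq_le q4 eqW)).
exact: (rank_eq_trans (q := 0) sE' sE (rank_eq_sym (rank_eq_le q4 eqW))).
Qed.

Theorem count_hardwired_MC_finite r (sigma : sentence r) :
  MC_finite (count_hardwired sigma).
Proof.
move=> m m_gt0; pose M := (modulus sigma * m).-1.
have ME : M.+1 = modulus sigma * m by rewrite prednK // muln_gt0 modulus_gt0.
(* Four ranks decide transitivity, [depth sigma] ranks decide the sentence. *)
pose q := maxn 4 (depth sigma).
have [|p [b [p_gt0 per]]] := @weighted_sum_periodic M q r m
  (fun n E => transitive_off E *
     [exists c : {ffun 'I_r -> 'I_n}, hardwired c && models (upsets E) c sigma]) m_gt0;
  last by exists p, b; split=> // n le_n; rewrite !count_hardwiredE per.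
move=> n n' E E' le_n le_n' sE sE' e.
rewrite (transitive_off_rank sE sE' _ e) ?leq_max //.
rewrite (hardwired_models sigma _ le_n) (hardwired_models sigma _ le_n').
rewrite (models_rank (j := id) (c' := finfun (widen_ord le_n')) (sigma := sigma) _ _ e) //.
- by rewrite leq_maxr.
- by rewrite ME dvdn_mulr.
- by move=> i; apply/setP=> j; rewrite !inE ffunE -val_eqE.
by move=> i; apply/setP=> j; rewrite !inE ffunE -val_eqE.
Qed.

Theorem count_free_MC_finite r (sigma : sentence r) : MC_finite (count_free sigma).
Proof.
(* The factor [m] lets the type determine the number of satisfying interpretations modulo [m]. No
   point is marked here, since the constants are summed over. *)
move=> m m_gt0; pose M := (modulus sigma * m).-1.
have ME : M.+1 = modulus sigma * m by rewrite prednK // muln_gt0 modulus_gt0.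
pose d := depth sigma; pose q := maxn 4 (d + 3 * r).+1.
have [|p [b [p_gt0 per]]] := @weighted_sum_periodic M q 0 m
  (fun n E => transitive_off E *
     \sum_(c : {ffun 'I_r -> 'I_n}) models (upsets E) c sigma) m_gt0;
  last by exists p, b; split=> // n le_n; rewrite !count_freeE per.
move=> n n' E E' _ _ sE sE' e.
rewrite (transitive_off_rank sE sE' _ e) ?leq_max //.
apply: eq_modnM => //.
have dvd_m : m %| M.+1 by rewrite ME dvdn_mull.
rewrite -(modn_dvdm _ dvd_m) -[RHS](modn_dvdm _ dvd_m); congr (_ %% _).
apply: (@rank_sum_ffun M r (fun T E c => models (upsets E) c sigma) d _ _ _ _ _ 0
  (@marks 0 n) (@marks 0 n')).
  move=> T T' F F' w W W' j c c' eW Wc Wc'; congr (nat_of_bool _ %% _).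
  apply: (models_rank _ _ eW Wc Wc') => //.
  by rewrite ME dvdn_mulr.
by apply: rank_eq_le e; rewrite leq_maxr.
Qed.

(** * Growth of C-finite sequences and of the number of topologies *)

Lemma C_finite_bound s : C_finite s -> exists C K, forall n, s n <= C * K ^ n.
Proof.
case=> p [b [c rec]].
(* [C] dominates the initial values below [b + p], and [K] exceeds the sum of the absolute values of
   the coefficients; the successor keeps [K] positive. *)
pose K := (\sum_(i < p) `|c i|%N).+1; pose C := \sum_(n < b + p) s n.
exists C, K => n; have [k] := ubnP n; elim: k n => // k IHk n; rewrite ltnS => le_nk.
have K_gt0 j : 0 < K ^ j by rewrite expn_gt0.
have [lt_n|ge_n] := ltnP n (b + p).
  apply: (@leq_trans C); last exact: leq_pmulr.
  by rewrite /C (bigD1 (Ordinal lt_n)) //= leq_addr.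
have le_pn : p <= n := leq_trans (leq_addl _ _) ge_n.
have := rec (n - p); rewrite leq_subRL // addnC ge_n subnK // => /(_ isT) e.
have {e} : s n <= \sum_(i < p) `|c i|%N * s (n - p + i).
  rewrite -lez_nat e -!natz natr_sum; apply: le_trans (ler_norm _) _.
  apply: le_trans (ler_norm_sum _ _ _) _.
  apply: ler_sum => i _; rewrite normrM natz PoszM abszE //.
case: (posnP p) => [p0|p_gt0] h.
  apply: leq_trans h _; rewrite big1 // => i _.
  by have := ltn_ord i; rewrite [X in _ < X -> _]p0.
apply: leq_trans h _.
apply: (@leq_trans (\sum_(i < p) `|c i|%N * (C * K ^ n.-1))).
  apply: leq_sum => i _; rewrite leq_mul2l; apply/orP; right.
  have lt_i : n - p + i < n by rewrite -[X in _ < X](subnK le_pn) ltn_add2l.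
  apply: leq_trans (IHk _ (leq_trans lt_i le_nk)) _.
  rewrite leq_mul2l; apply/orP; right; apply: leq_pexp2l => //.
  by rewrite -ltnS prednK // (leq_trans p_gt0).
have n_gt0 : 0 < n := leq_trans p_gt0 le_pn.
rewrite -big_distrl /= mulnCA leq_mul2l -[in X in _ <= X](prednK n_gt0) expnS leq_mul2r.
by rewrite leqnSn !orbT.
Qed.

(** All relations from the lower half to the upper half qualify: no two of their edges compose, so
    they are vacuously transitive. *)
Lemma card_topology_bound k :
  2 ^ (k * k) <= #|[set O : {set {set 'I_(k + k)}} | is_topology O]|.
Proof.
rewrite topology_upsets card_in_imset; last exact: upsets_inj.
pose A := [set i : 'I_(k + k) | i < k].
have cA : #|A| = k.
  rewrite -[RHS]card_ord -(card_imset _ (@lshift_inj k k)); apply: eq_card => i.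
  rewrite inE; apply/idP/imsetP => [lt_i|[j _ ->]]; last exact: (ltn_ord j).
  by exists (Ordinal lt_i) => //; apply: val_inj.
have cA' : #|~: A| = k by apply/eqP; rewrite -(eqn_add2l #|A|) cardsC card_ord cA.
have <- : #|setX A (~: A)| = k * k by rewrite cardsX cA cA'.
rewrite -card_powerset; apply: subset_leq_card.
apply/subsetP=> E; rewrite !inE => /subsetP sE.
have EP x y : (x, y) \in E -> (x \in A) /\ (y \notin A).
  by move/sE; rewrite in_setX /= in_setC => /andP[].
apply/andP; split.
  apply/subsetP=> -[x y] /EP[Ax nAy]; rewrite !inE /=.
  by apply: contraNneq nAy => <-.
by apply/transitive_offP=> x y z /EP[_ nAy] /EP[Ay]; rewrite Ay in nAy.
Qed.

Lemma not_both_C_finite (s t : nat -> nat) b :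
    (forall n, b <= n -> #|[set O : {set {set 'I_n}} | is_topology O]| <= s n + t n) ->
  ~ C_finite s \/ ~ C_finite t.
Proof.
move=> le_st; apply: not_and_or => -[/C_finite_bound[C [K sP]] /C_finite_bound[C' [K' tP]]].
(* Chosen so that [k * k] exceeds the exponent [(C + C') + (K + K') * (k + k)] and [k + k] exceeds
   the threshold [b]. *)
pose k := ((K + K').*2 + (C + C') + b).+1.
have: 2 ^ (k * k) <= (C + C') * (K + K') ^ (k + k).
  apply: leq_trans (card_topology_bound k) _.
  have le_b : b <= k + k by rewrite /k addSn leqW // -addnA addnC -!addnA leq_addr.
  apply: leq_trans (le_st _ le_b) _; rewrite mulnDl leq_add //.
    by apply: leq_trans (sP _) _; rewrite leq_mul2l leq_exp2r ?leq_addr ?orbT.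
  by apply: leq_trans (tP _) _; rewrite leq_mul2l leq_exp2r ?leq_addl ?orbT.
apply/negP; rewrite -ltnNge.
apply: (@leq_ltn_trans (2 ^ (C + C') * (2 ^ (K + K')) ^ (k + k))).
  by rewrite leq_mul // ?leq_exp2r //; apply/ltnW/ltn_expl.
rewrite -expnM -expnD ltn_exp2l //.
have kE : k = (K + K') + (K + K') + (C + C') + b + 1 by rewrite addnn addn1.
have D_le : C + C' <= (C + C') * k by rewrite leq_pmulr.
by rewrite [X in _ < X * _]kE mulnDr !mulnDl; rewrite !mulnDl in D_le; lia.
Qed.

Theorem theorem18 (r : nat) (sigma : sentence r) :
  [/\ MC_finite (count_hardwired sigma),
      MC_finite (count_hardwired (Not sigma)) &
      ~ C_finite (count_hardwired sigma) \/
      ~ C_finite (count_hardwired (Not sigma))] /\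
  [/\ MC_finite (count_free sigma),
      MC_finite (count_free (Not sigma)) &
      ~ C_finite (count_free sigma) \/
      ~ C_finite (count_free (Not sigma))].
Proof.
split; split.
- exact: count_hardwired_MC_finite.
- exact: count_hardwired_MC_finite.
(* From [r] on the hard-wired interpretation exists, so each topology is counted for [sigma] or for
   its negation; below [r] both counts are 0. *)
- apply: (@not_both_C_finite _ _ r) => n le_rn.
  apply: leq_trans (leq_card_setU _ _); apply: subset_leq_card.
  apply/subsetP=> O; rewrite !inE !(hardwired_models _ _ le_rn) => ->.
  by rewrite /models /=; case: holds.
- exact: count_free_MC_finite.
- exact: count_free_MC_finite.
apply: (@not_both_C_finite _ _ 1) => n n_gt0.
(* One fixed interpretation already injects the topologies into the counted pairs; [n] is positive
   so that the constants have a value. *)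
pose c0 : {ffun 'I_r -> 'I_n} := [ffun=> Ordinal n_gt0].
rewrite -(card_imset _ (f := fun O => (O, c0))); last by move=> O O' [].
apply: leq_trans (leq_card_setU _ _); apply: subset_leq_card.
apply/subsetP=> _ /imsetP[O + ->]; rewrite !inE => -> /=.
by rewrite /models /=; case: holds.
Qed.
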